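(* Let $\tau\neq 0$ be a real number and let $M$ be a constant angle surface in the Heisenberg group $\mathrm{Nil}_3$ (with parameter $\tau$), with constant angle $\theta\in[0,\frac{\pi}{2}]$. Then, locally (i.e. in a neighbourhood of each of its points) and up to an isometry of $\mathrm{Nil}_3$, $M$ is an open part of one of the following types of surfaces: (i) a Hopf cylinder; (ii) a surface given by $$F(u,v)=\Big(\tfrac{1}{2\tau}\tan\theta\,\sin u+f_1(v),\ -\tfrac{1}{2\tau}\tan\theta\,\cos u+f_2(v),\ -\tfrac{1}{4\tau}\tan^2\theta\,u-\tfrac12\tan\theta\,\cos u\,f_1(v)-\tfrac12\tan\theta\,\sin u\,f_2(v)-\tau f_3(v)\Big),$$ where $f_1,f_2,f_3$ are smooth real functions of $v$ on an interval satisfying $(f_1')^2+(f_2')^2=\sin^2\theta$ and $f_3'(v)=f_1'(v)f_2(v)-f_1(v)f_2'(v)$, and where $\theta$ is the constant angle of $M$ (with $\theta\neq\frac{\pi}{2}$ in this case, so that $\tan\theta$ is defined).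
   Context: For a non-zero real number $\tau$, $\mathrm{Nil}_3$ denotes $\mathbb{R}^3$ with coordinates $(x,y,z)$ and the Riemannian metric $ds^2=dx^2+dy^2+(dz+\tau(y\,dx-x\,dy))^2$ (a left-invariant metric on the 3-dimensional Heisenberg group). A left-invariant orthonormal frame is $e_1=\partial_x-\tau y\,\partial_z$, $e_2=\partial_y+\tau x\,\partial_z$, $e_3=\partial_z$. The Hopf fibration is the Riemannian submersion $\mathrm{Nil}_3\to\mathbb{E}^2$, $(x,y,z)\mapsto(x,y)$, whose fibers are the integral curves of $e_3$; a Hopf cylinder is the inverse image under it of a curve in $\mathbb{E}^2$. A surface $M$ isometrically immersed in $\mathrm{Nil}_3$, oriented with unit normal vector field $N$, is called a constant angle surface if the angle $\theta$ between $N$ and $e_3$ is the same at every point. Working locally, one may choose $N$ so that $\theta\in[0,\frac{\pi}{2}]$. Here ''open part'' of a parametrized surface means its restriction to an open set of parameters. *)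

(* Defs.v *)
(** Stdlib's reals, with Coquelicot. *)
From Stdlib Require Import Reals.
From Coquelicot Require Import Coquelicot.
Open Scope R_scope.

Section Smooth.
Context {V : NormedModule R_AbsRing}.

(** [dderiv f p v] is the differential of [f] at [p] applied to [v]. *)
Definition dderiv (f : V -> R) (p v : V) : R :=
  Derive (fun t : R => f (plus p (scal t v))) 0.

(** Class C^k on [U].  Meant for [U] open in a finite-dimensional [V], where
    quantifying over all directions [v] amounts to quantifying over a basis. *)
Fixpoint Ck_on (k : nat) (U : V -> Prop) (f : V -> R) : Prop :=
  (forall p, U p -> continuous f p) /\
  match k with
  | O => True
  | S k' =>
      forall v : V,
        (forall p, U p -> ex_derive (fun t : R => f (plus p (scal t v))) 0) /\
        Ck_on k' U (fun p => dderiv f p v)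
  end.

Definition smooth_on (U : V -> Prop) (f : V -> R) : Prop :=
  forall k : nat, Ck_on k U f.

End Smooth.

Definition coordx (p : R * R * R) : R := fst (fst p).
Definition coordy (p : R * R * R) : R := snd (fst p).
Definition coordz (p : R * R * R) : R := snd p.

Definition smooth_map2 {V : NormedModule R_AbsRing} (U : V -> Prop)
    (h : V -> R * R) : Prop :=
  smooth_on U (fun p => fst (h p)) /\ smooth_on U (fun p => snd (h p)).

Definition smooth_map3 {V : NormedModule R_AbsRing} (U : V -> Prop)
    (F : V -> R * R * R) : Prop :=
  smooth_on U (fun p => coordx (F p)) /\
  smooth_on U (fun p => coordy (F p)) /\
  smooth_on U (fun p => coordz (F p)).

Definition dmap3 {V : NormedModule R_AbsRing} (F : V -> R * R * R)
    (p v : V) : R * R * R :=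
  (dderiv (fun q => coordx (F q)) p v,
   dderiv (fun q => coordy (F q)) p v,
   dderiv (fun q => coordz (F q)) p v).

Definition diffeomorphism2 (U W : R * R -> Prop) (h : R * R -> R * R) : Prop :=
  exists k : R * R -> R * R,
    smooth_map2 U h /\ smooth_map2 W k /\
    (forall p, U p -> W (h p) /\ k (h p) = p) /\
    (forall q, W q -> U (k q) /\ h (k q) = q).

Definition immersion (U : R * R -> Prop) (X : R * R -> R * R * R) : Prop :=
  smooth_map3 U X /\
  forall p, U p -> forall v : R * R, dmap3 X p v = zero -> v = zero.

Definition interval_oo (a b : Rbar) (s : R) : Prop :=
  Rbar_lt a s /\ Rbar_lt s b.

(** Tangent vectors at a point of [R * R * R] are written in the coordinate
    frame (d/dx, d/dy, d/dz). *)

Definition nil_form (tau : R) (p v : R * R * R) : R :=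
  coordz v + tau * (coordy p * coordx v - coordx p * coordy v).

(** Polarization of ds^2 = dx^2 + dy^2 + (dz + tau (y dx - x dy))^2. *)
Definition nil_metric (tau : R) (p v w : R * R * R) : R :=
  coordx v * coordx w + coordy v * coordy w +
  nil_form tau p v * nil_form tau p w.

Definition nil_norm (tau : R) (p v : R * R * R) : R :=
  sqrt (nil_metric tau p v v).

Definition nil_angle (tau : R) (p v w : R * R * R) : R :=
  acos (nil_metric tau p v w / (nil_norm tau p v * nil_norm tau p w)).

Definition nil_e3 : R * R * R := (0, 0, 1).

Definition nil_isometry (tau : R) (Phi : R * R * R -> R * R * R) : Prop :=
  smooth_map3 (fun _ => True) Phi /\
  (exists Psi : R * R * R -> R * R * R,
     smooth_map3 (fun _ => True) Psi /\
     (forall p, Psi (Phi p) = p) /\ (forall p, Phi (Psi p) = p)) /\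
  (forall p v w : R * R * R,
     nil_metric tau (Phi p) (dmap3 Phi p v) (dmap3 Phi p w) =
     nil_metric tau p v w).

(** [N] is a vector field along [X]: [N p] is tangent to Nil_3 at [X p]. *)
Definition unit_normal_field (tau : R) (U : R * R -> Prop)
    (X N : R * R -> R * R * R) : Prop :=
  smooth_map3 U N /\
  forall p, U p ->
    nil_norm tau (X p) (N p) = 1 /\
    forall v : R * R, nil_metric tau (X p) (N p) (dmap3 X p v) = 0.

(** The surface is the immersed patch [X] on [U], carrying the metric induced
    by [X]. *)
Definition constant_angle_surface (tau theta : R) (U : R * R -> Prop)
    (X N : R * R -> R * R * R) : Prop :=
  open U /\ immersion U X /\ unit_normal_field tau U X N /\
  forall p, U p -> nil_angle tau (X p) (N p) nil_e3 = theta.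

Definition hopf_fibration (p : R * R * R) : R * R := (coordx p, coordy p).

Definition regular_curve (a b : Rbar) (c : R -> R * R) : Prop :=
  smooth_map2 (interval_oo a b) c /\
  forall s, interval_oo a b s ->
    (Derive (fun t => fst (c t)) s, Derive (fun t => snd (c t)) s) <> (0, 0).

Definition hopf_cylinder (a b : Rbar) (c : R -> R * R) (q : R * R * R) : Prop :=
  exists s, interval_oo a b s /\ hopf_fibration q = c s.

Definition open_part_of_set (U : R * R -> Prop) (X : R * R -> R * R * R)
    (S : R * R * R -> Prop) : Prop :=
  exists O : R * R * R -> Prop, open O /\
    forall q, (exists p, U p /\ X p = q) <-> (O q /\ S q).

(** Up to a change of parameters, [X] on [U] is the restriction of [F] to an
    open set of parameters contained in [D]. *)
Definition open_part_of_param (U : R * R -> Prop) (X : R * R -> R * R * R)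
    (D : R * R -> Prop) (F : R * R -> R * R * R) : Prop :=
  exists (W : R * R -> Prop) (h : R * R -> R * R),
    open W /\ (forall q, W q -> D q) /\ diffeomorphism2 U W h /\
    forall p, U p -> X p = F (h p).

Definition type_ii_data (theta : R) (a b : Rbar) (f1 f2 f3 : R -> R) : Prop :=
  smooth_on (interval_oo a b) f1 /\
  smooth_on (interval_oo a b) f2 /\
  smooth_on (interval_oo a b) f3 /\
  forall v, interval_oo a b v ->
    Derive f1 v ^ 2 + Derive f2 v ^ 2 = sin theta ^ 2 /\
    Derive f3 v = Derive f1 v * f2 v - f1 v * Derive f2 v.

Definition type_ii_param (tau theta : R) (f1 f2 f3 : R -> R) (q : R * R) :
    R * R * R :=
  let u := fst q in
  let v := snd q in
  (1 / (2 * tau) * tan theta * sin u + f1 v,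
   - (1 / (2 * tau)) * tan theta * cos u + f2 v,
   - (1 / (4 * tau)) * tan theta ^ 2 * u
   - 1 / 2 * tan theta * cos u * f1 v
   - 1 / 2 * tan theta * sin u * f2 v
   - tau * f3 v).

(* Main.v *)
Require Import Defs.
From Stdlib Require Import Reals Lra ClassicalEpsilon.
From Coquelicot Require Import Coquelicot.
Open Scope R_scope.

(** The isometry is the identity in every case; all the work is in choosing
    coordinates on the surface.

    Write the immersion as [(x, y, z)] and the unit normal in the frame
    [e1, e2, e3] as [(n1, n2, n3)].  Then [n3 = cos theta],
    [n1^2 + n2^2 = sin^2 theta], and the normal annihilates the tangent plane:
<<
      n1 dx + n2 dy + cos theta (dz + tau (y dx - x dy)) = 0.
>>
    If [theta = PI/2], the forms [dx] and [dy] are proportional on the surface,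
    so its projection to the plane has rank one.  With [z] and one of [x], [y]
    as coordinates, the other of [x], [y] depends on a single coordinate, and
    the surface is an open part of the cylinder over a graph
    ([vertical_surface]).

    If [theta < PI/2], then [dx /\ dy] is nowhere zero, since the normal is not
    horizontal.  The exterior derivative of the relation above
    ([normal_form_closed]) reads
<<
      dn1 /\ dx + dn2 /\ dy = 2 tau cos theta dx /\ dy.
>>
    For [theta = 0] its left side vanishes, which is impossible: the horizontal
    distribution has no integral surfaces.  For [0 < theta] write
    [n1 = sin theta cos phi] and [n2 = sin theta sin phi] with a smooth angle
    [phi] ([smooth_angle]), and put [r = tan theta / (2 tau)].  The relation
    then says exactly that [dA /\ dB = 0] for
<<
      A = x - r sin phi,   B = y + r cos phi,
>>
    the centre of the circle along which the projected point moves while [phi]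
    turns.  So [(A, B)] runs along a curve.  Parametrizing this curve with
    constant speed [sin theta] by a parameter [v], and using [(phi, v)] as
    coordinates ([rank_one_reparametrization]), one gets [A = f1 v] and
    [B = f2 v], that is, the first two components of the parametrization.  The
    third one defines a function [f3] on the surface whose differential is
    [B dA - A dB]; hence [f3] too is a function of [v], with the required
    derivative ([rotating_normal_surface]).

    Two analytic tools carry this: the smooth inverse function theorem in the
    plane ([inverse_function]), and the fact that a function whose differential
    vanishes on the kernel of the differential of a coordinate is a smooth
    function of that coordinate ([factor_through_second]). *)

(** * Smooth functions on open sets of a normed space *)

Section Calculus.
Context {V : NormedModule R_AbsRing}.
Implicit Types (U : V -> Prop) (f g : V -> R) (p v : V).

Definition is_dderiv f p v (l : R) : Prop :=
  is_derive (fun t : R => f (plus p (scal t v))) 0 l.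

Lemma is_dderiv_unique f p v l : is_dderiv f p v l -> dderiv f p v = l.
Proof. apply is_derive_unique. Qed.

Lemma line_0 p v : plus p (scal 0 v) = p.
Proof.
  etransitivity; [apply f_equal; apply (scal_zero_l v) | apply plus_zero_r].
Qed.

Lemma locally_line U p v :
  open U -> U p -> locally 0 (fun t : R => U (plus p (scal t v))).
Proof.
  intros HU Up.
  assert (Hc : continuous (fun t : R => plus p (scal t v)) 0).
  { apply (continuous_plus (fun _ : R => p) (fun t : R => scal t v)).
    - apply continuous_const.
    - apply (continuous_scal_l (fun t : R => t) v). apply continuous_id. }
  apply Hc. apply HU. now rewrite line_0.
Qed.

Lemma Ck_on_ext k U f g :
  open U -> (forall p, U p -> f p = g p) -> Ck_on k U f -> Ck_on k U g.
Proof.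
  intros HU; revert f g.
  induction k as [|k IH]; intros f g E [Hc Hd]; split; auto.
  1, 2: intros p Up; apply (continuous_ext_loc _ f); auto;
    apply (filter_imp U); auto.
  intros v; destruct (Hd v) as [Hd1 Hd2].
  assert (L : forall p, U p ->
    locally 0 (fun t : R => f (plus p (scal t v)) = g (plus p (scal t v)))).
  { intros p Up; generalize (locally_line U p v HU Up).
    apply filter_imp; intros t; apply E. }
  split.
  - intros p Up; apply (ex_derive_ext_loc (fun t : R => f (plus p (scal t v)))); auto.
  - apply (IH (fun p => dderiv f p v)); auto.
    intros p Up; apply Derive_ext_loc; auto.
Qed.

(** A formula for all directional derivatives reduces order [S k] to order [k];
    it drives the inductions on [k] below. *)
Lemma Ck_on_S k U f (df : V -> V -> R) :
  open U ->
  (forall p, U p -> continuous f p) ->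
  (forall v p, U p -> is_dderiv f p v (df v p)) ->
  (forall v, Ck_on k U (df v)) ->
  Ck_on (S k) U f.
Proof.
  intros HU Hc Hd Hk; split; auto; intros v; split.
  - intros p Up; exists (df v p); apply Hd; auto.
  - apply (Ck_on_ext k U (df v)); auto.
    intros p Up; symmetry; apply is_dderiv_unique; auto.
Qed.

Lemma Ck_on_continuous k U f p : Ck_on k U f -> U p -> continuous f p.
Proof. destruct k; intros [H _]; auto. Qed.

Lemma Ck_on_is_dderiv k U f p v :
  Ck_on (S k) U f -> U p -> is_dderiv f p v (dderiv f p v).
Proof. intros [_ H] Up; apply Derive_correct, (proj1 (H v)); auto. Qed.

Lemma Ck_on_dderiv k U f v :
  Ck_on (S k) U f -> Ck_on k U (fun p => dderiv f p v).
Proof. intros [_ H]; apply H. Qed.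

Lemma Ck_on_pred k U f : Ck_on (S k) U f -> Ck_on k U f.
Proof.
  revert f; induction k as [|k IH]; intros f [Hc Hd]; split; auto.
  intros v; destruct (Hd v); split; auto.
Qed.

Lemma Ck_on_subset k U U' f :
  (forall p, U' p -> U p) -> Ck_on k U f -> Ck_on k U' f.
Proof.
  intros HS; revert f; induction k as [|k IH]; intros f [Hc Hd]; split; auto.
  intros v; destruct (Hd v); split; auto.
Qed.

Lemma is_dderiv_const c p v :
  is_dderiv (fun _ => c) p v 0.
Proof. apply (@is_derive_const R_AbsRing R_NormedModule c 0). Qed.

Lemma is_dderiv_plus f g p v a b :
  is_dderiv f p v a -> is_dderiv g p v b ->
  is_dderiv (fun q => f q + g q) p v (a + b).
Proof.
  apply (is_derive_plus (fun t : R => f (plus p (scal t v)))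
    (fun t : R => g (plus p (scal t v)))).
Qed.

Lemma is_dderiv_minus f g p v a b :
  is_dderiv f p v a -> is_dderiv g p v b ->
  is_dderiv (fun q => f q - g q) p v (a - b).
Proof.
  apply (is_derive_minus (fun t : R => f (plus p (scal t v)))
    (fun t : R => g (plus p (scal t v)))).
Qed.

Lemma is_dderiv_mult f g p v a b :
  is_dderiv f p v a -> is_dderiv g p v b ->
  is_dderiv (fun q => f q * g q) p v (a * g p + f p * b).
Proof.
  intros Hf Hg.
  replace (a * g p + f p * b) with
    (a * g (plus p (scal 0 v)) + f (plus p (scal 0 v)) * b) by now rewrite line_0.
  exact (is_derive_mult (fun t : R => f (plus p (scal t v)))
    (fun t : R => g (plus p (scal t v))) 0 a b Hf Hg Rmult_comm).
Qed.

Lemma Ck_on_const k U (c : R) : open U -> Ck_on k U (fun _ => c).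
Proof.
  intros HU; revert c; induction k as [|k IH]; intros c.
  - split; auto; intros; apply continuous_const.
  - apply (Ck_on_S k U _ (fun _ _ => 0)); auto.
    + intros; apply continuous_const.
    + intros v p _; apply is_dderiv_const.
Qed.

Lemma Ck_on_plus k U f g :
  open U -> Ck_on k U f -> Ck_on k U g -> Ck_on k U (fun p => f p + g p).
Proof.
  intros HU; revert f g; induction k as [|k IH]; intros f g Hf Hg.
  - split; auto; intros p Up.
    apply (continuous_plus f g); eapply Ck_on_continuous; eauto.
  - apply (Ck_on_S k U _ (fun v p => dderiv f p v + dderiv g p v)); auto.
    + intros p Up; apply (continuous_plus f g); eapply Ck_on_continuous; eauto.
    + intros v p Up.
      apply is_dderiv_plus; eapply Ck_on_is_dderiv; eauto.
    + intros v; apply IH; apply Ck_on_dderiv; auto.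
Qed.

Lemma Ck_on_mult k U f g :
  open U -> Ck_on k U f -> Ck_on k U g -> Ck_on k U (fun p => f p * g p).
Proof.
  intros HU; revert f g; induction k as [|k IH]; intros f g Hf Hg.
  - split; auto; intros p Up.
    apply (continuous_mult f g); eapply Ck_on_continuous; eauto.
  - apply (Ck_on_S k U _ (fun v p => dderiv f p v * g p + f p * dderiv g p v)); auto.
    + intros p Up; apply (continuous_mult f g); eapply Ck_on_continuous; eauto.
    + intros v p Up; apply is_dderiv_mult; eapply Ck_on_is_dderiv; eauto.
    + intros v; apply Ck_on_plus; auto; apply IH;
        auto using Ck_on_dderiv, Ck_on_pred.
Qed.

Lemma is_dderiv_comp1 (phi : R -> R) f p v a l :
  is_derive phi (f p) l -> is_dderiv f p v a ->
  is_dderiv (fun q => phi (f q)) p v (a * l).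
Proof.
  intros Hphi Hf.
  apply (is_derive_comp phi (fun t : R => f (plus p (scal t v))) 0 l a); auto.
  now rewrite line_0.
Qed.

End Calculus.

Lemma is_dderiv_R (phi : R -> R) (x v l : R) :
  is_derive phi x l -> is_dderiv phi x v (v * l).
Proof.
  intros H.
  apply (is_derive_comp phi (fun t : R => x + t * v) 0 l v).
  - now replace (x + 0 * v) with x by ring.
  - auto_derive; auto; ring.
Qed.

Lemma dderiv_R1 (phi : R -> R) (x : R) : dderiv phi x 1 = Derive phi x.
Proof.
  unfold dderiv.
  change (Derive (fun t => phi (x + t * 1)) 0 = Derive phi x).
  rewrite (Derive_ext _ (fun t => phi (t + x))) by (intros; f_equal; ring).
  unfold Derive; f_equal; apply Lim_ext; intros h.
  f_equal; f_equal; f_equal; ring.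
Qed.

Lemma is_dderiv_R_is_derive (phi : R -> R) (x l : R) :
  is_dderiv phi x 1 l -> is_derive phi x l.
Proof.
  unfold is_dderiv; intros H.
  apply (is_derive_ext (fun y => phi (x + (y - x) * 1))).
  - intros t; f_equal; ring.
  - replace l with (1 * l) by ring.
    apply (is_derive_comp (fun t => phi (x + t * 1)) (fun y => y - x) x l 1).
    + now replace (x - x) with 0 by ring.
    + auto_derive; auto; ring.
Qed.

Lemma Ck_on_is_derive k (D : R -> Prop) phi x :
  Ck_on (S k) D phi -> D x -> is_derive phi x (Derive phi x).
Proof.
  intros H Dx; rewrite <- dderiv_R1; apply is_dderiv_R_is_derive.
  eapply Ck_on_is_dderiv; eauto.
Qed.

Lemma Ck_on_Derive k (D : R -> Prop) phi :
  open D -> Ck_on (S k) D phi -> Ck_on k D (Derive phi).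
Proof.
  intros HD H; apply (Ck_on_ext k D (fun x => dderiv phi x 1)); auto.
  - intros; apply dderiv_R1.
  - apply (Ck_on_dderiv k D phi 1); auto.
Qed.

Lemma Ck_on_S_R k (D : R -> Prop) phi dphi :
  open D -> (forall x, D x -> is_derive phi x (dphi x)) ->
  Ck_on k D dphi -> Ck_on (S k) D phi.
Proof.
  intros HD Hd Hk.
  apply (Ck_on_S k D phi (fun v x => v * dphi x)); auto.
  - intros x Dx; apply (@ex_derive_continuous R_AbsRing R_NormedModule).
    exists (dphi x); auto.
  - intros v x Dx; apply is_dderiv_R; auto.
  - intros v; apply (Ck_on_mult k D (fun _ => v) dphi); auto using Ck_on_const.
Qed.

Lemma Ck_on_comp1 {V : NormedModule R_AbsRing} k (U : V -> Prop)
    (D : R -> Prop) phi f :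
  open U -> open D -> (forall p, U p -> D (f p)) ->
  Ck_on k D phi -> Ck_on k U f -> Ck_on k U (fun p => phi (f p)).
Proof.
  intros HU HD HUD; revert phi; induction k as [|k IH]; intros phi Hphi Hf.
  - split; auto; intros p Up.
    apply (continuous_comp f phi).
    + apply (Ck_on_continuous 0 U); auto.
    + apply (Ck_on_continuous 0 D phi); auto.
  - apply (Ck_on_S k U _ (fun v p => dderiv f p v * Derive phi (f p))); auto.
    + intros p Up; apply (continuous_comp f phi).
      * apply (Ck_on_continuous (S k) U); auto.
      * apply (Ck_on_continuous (S k) D phi); auto.
    + intros v p Up; apply is_dderiv_comp1.
      * apply (Ck_on_is_derive k D); auto.
      * apply (Ck_on_is_dderiv k U); auto.
    + intros v; apply Ck_on_mult; auto using Ck_on_dderiv.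
      apply IH; auto using Ck_on_pred, Ck_on_Derive.
Qed.

Section SmoothAlgebra.
Context {V : NormedModule R_AbsRing}.
Implicit Types (U : V -> Prop) (f g : V -> R).

Lemma smooth_on_ext U f g :
  open U -> (forall p, U p -> f p = g p) -> smooth_on U f -> smooth_on U g.
Proof. intros HU E H k; apply (Ck_on_ext k U f); auto. Qed.

Lemma smooth_on_subset U U' f :
  (forall p, U' p -> U p) -> smooth_on U f -> smooth_on U' f.
Proof. intros E H k; apply (Ck_on_subset k U); auto. Qed.

Lemma smooth_on_continuous U f p : smooth_on U f -> U p -> continuous f p.
Proof. intros H; apply (Ck_on_continuous 0); auto. Qed.

Lemma smooth_on_is_dderiv U f p v :
  smooth_on U f -> U p -> is_dderiv f p v (dderiv f p v).
Proof. intros H; apply (Ck_on_is_dderiv 0); auto. Qed.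

Lemma smooth_on_dderiv U f v :
  smooth_on U f -> smooth_on U (fun p => dderiv f p v).
Proof. intros H k; apply Ck_on_dderiv; auto. Qed.

Lemma smooth_on_const U (c : R) : open U -> smooth_on U (fun _ => c).
Proof. intros HU k; now apply Ck_on_const. Qed.

Lemma smooth_on_plus U f g :
  open U -> smooth_on U f -> smooth_on U g -> smooth_on U (fun p => f p + g p).
Proof. intros HU Hf Hg k; now apply Ck_on_plus. Qed.

Lemma smooth_on_mult U f g :
  open U -> smooth_on U f -> smooth_on U g -> smooth_on U (fun p => f p * g p).
Proof. intros HU Hf Hg k; now apply Ck_on_mult. Qed.

Lemma smooth_on_opp U f :
  open U -> smooth_on U f -> smooth_on U (fun p => - f p).
Proof.
  intros HU Hf; apply (smooth_on_ext U (fun p => (-1) * f p)); auto.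
  - intros; ring.
  - apply smooth_on_mult; auto using smooth_on_const.
Qed.

Lemma smooth_on_minus U f g :
  open U -> smooth_on U f -> smooth_on U g -> smooth_on U (fun p => f p - g p).
Proof.
  intros HU Hf Hg; apply (smooth_on_plus U f (fun p => - g p));
    auto using smooth_on_opp.
Qed.

Lemma smooth_on_comp1 U (D : R -> Prop) phi f :
  open U -> open D -> (forall p, U p -> D (f p)) ->
  smooth_on D phi -> smooth_on U f -> smooth_on U (fun p => phi (f p)).
Proof. intros HU HD HUD Hp Hf k; apply (Ck_on_comp1 k U D); auto. Qed.

End SmoothAlgebra.

Lemma smooth_on_R (D : R -> Prop) phi dphi :
  open D -> (forall x, D x -> is_derive phi x (dphi x)) ->
  smooth_on D dphi -> smooth_on D phi.
Proof.
  intros HD Hd Hs [|k].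
  - apply Ck_on_pred; apply (Ck_on_S_R 0 D phi dphi); auto.
  - apply (Ck_on_S_R k D phi dphi); auto.
Qed.

Lemma smooth_on_Derive (D : R -> Prop) phi :
  open D -> smooth_on D phi -> smooth_on D (Derive phi).
Proof. intros HD H k; apply Ck_on_Derive; auto. Qed.

Lemma smooth_on_is_derive (D : R -> Prop) phi (x : R) :
  smooth_on D phi -> D x -> is_derive phi x (Derive phi x).
Proof. intros H; apply (Ck_on_is_derive 0); auto. Qed.

Lemma smooth_on_id (D : R -> Prop) : open D -> smooth_on D (fun x => x).
Proof.
  intros HD; apply (smooth_on_R D _ (fun _ => 1)); auto using smooth_on_const.
  intros; apply (@is_derive_id R_AbsRing).
Qed.

Lemma open_R : @open R_UniformSpace (fun _ : R => True).
Proof. apply open_true. Qed.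

(** Each function is the derivative of the other up to sign, so the two
    inductions must run together. *)
Lemma smooth_sin_cos : smooth_on (fun _ => True) sin /\ smooth_on (fun _ => True) cos.
Proof.
  assert (H : forall k, Ck_on k (fun _ => True) sin /\ Ck_on k (fun _ => True) cos).
  { induction k as [|k [Hs Hc]].
    - split; split; auto; intros x _.
      apply continuous_sin. apply continuous_cos.
    - split.
      + apply (Ck_on_S_R k _ sin cos); auto using open_R.
        intros; apply is_derive_sin.
      + apply (Ck_on_S_R k _ cos (fun x => - 1 * sin x)); auto using open_R.
        * intros x _; replace (-1 * sin x) with (- sin x) by ring.
          apply is_derive_cos.
        * apply (Ck_on_mult k _ (fun _ => -1) sin);
            auto using open_R, Ck_on_const. }
  split; intros k; apply H.
Qed.

Lemma smooth_inv : smooth_on (fun x => x <> 0) Rinv.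
Proof.
  assert (HO : open (fun x : R => x <> 0)) by apply open_neq.
  assert (Hd : forall x, x <> 0 -> is_derive Rinv x ((-1 * / x) * / x)).
  { intros x Hx. replace ((-1 * / x) * / x) with (- 1 / x ^ 2) by (field; auto).
    apply (is_derive_inv (fun y => y) x 1); auto. apply (@is_derive_id R_AbsRing). }
  intros k; induction k as [|k IH].
  - split; auto; intros x Hx.
    apply (@ex_derive_continuous R_AbsRing R_NormedModule).
    eexists; apply Hd; auto.
  - apply (Ck_on_S_R k _ _ _ HO Hd).
    apply (Ck_on_mult k _ (fun x => -1 * / x) Rinv); auto.
    apply (Ck_on_mult k _ (fun _ => -1) Rinv); auto using Ck_on_const.
Qed.

Lemma smooth_on_inv {V : NormedModule R_AbsRing} (U : V -> Prop) f :
  open U -> (forall p, U p -> f p <> 0) ->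
  smooth_on U f -> smooth_on U (fun p => / f p).
Proof.
  intros HU Hn Hf; apply (smooth_on_comp1 U (fun x => x <> 0)); auto.
  apply open_neq. apply smooth_inv.
Qed.

Lemma smooth_atan : smooth_on (fun _ => True) atan.
Proof.
  apply (smooth_on_R _ atan (fun x => / (1 + x * x))); auto using open_R.
  - intros x _; apply is_derive_atan.
  - apply smooth_on_inv; auto using open_R.
    + intros x _; nra.
    + apply smooth_on_plus; auto using open_R, smooth_on_const.
      apply smooth_on_mult; auto using open_R, smooth_on_id.
Qed.

Lemma smooth_sqrt : smooth_on (fun x => 0 < x) sqrt.
Proof.
  assert (HO : open (fun x : R => 0 < x)) by apply open_gt.
  assert (Hd : forall x, 0 < x -> is_derive sqrt x (/ (2 * sqrt x))).
  { intros x Hx. replace (/ (2 * sqrt x)) with (1 / (2 * sqrt x)) by (unfold Rdiv; ring).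
    apply (is_derive_sqrt (fun y => y) x 1); auto. apply (@is_derive_id R_AbsRing). }
  intros k; induction k as [|k IH].
  - split; auto; intros x Hx.
    apply (@ex_derive_continuous R_AbsRing R_NormedModule).
    eexists; apply Hd; auto.
  - apply (Ck_on_S_R k _ _ _ HO Hd).
    apply (Ck_on_comp1 k _ (fun x => x <> 0) Rinv); auto.
    + apply open_neq.
    + intros x Hx; pose proof (sqrt_lt_R0 x Hx); lra.
    + apply smooth_inv.
    + apply (Ck_on_mult k _ (fun _ => 2) sqrt); auto using Ck_on_const.
Qed.

(** * Differentials in the plane *)

Definition partial1 (f : R * R -> R) (p : R * R) : R := dderiv f p (1, 0).
Definition partial2 (f : R * R -> R) (p : R * R) : R := dderiv f p (0, 1).

Definition box (q : R * R) (r : R) (p : R * R) : Prop :=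
  Rabs (fst p - fst q) < r /\ Rabs (snd p - snd q) < r.

Lemma box_center q r : 0 < r -> box q r q.
Proof. intros Hr; split; rewrite Rminus_diag, Rabs_R0; auto. Qed.

Lemma box_le q r r' p : r <= r' -> box q r p -> box q r' p.
Proof. intros Hr [H1 H2]; split; lra. Qed.

Lemma locally_box (P : R * R -> Prop) q :
  locally q P -> exists r, 0 < r /\ forall p, box q r p -> P p.
Proof.
  intros [e He]; exists e; split; [apply cond_pos|].
  intros p [H1 H2]; apply He; split; auto.
Qed.

Lemma box_locally (P : R * R -> Prop) q r :
  0 < r -> (forall p, box q r p -> P p) -> locally q P.
Proof.
  intros Hr H; exists (mkposreal r Hr); intros p [H1 H2]; apply H; split; auto.
Qed.

Lemma open_box q r : open (box q r).
Proof.
  intros [x y] [H1 H2]; simpl in H1, H2.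
  set (e := Rmin (r - Rabs (x - fst q)) (r - Rabs (y - snd q))).
  assert (He : 0 < e) by (apply Rmin_glb_lt; lra).
  assert (Hx : e <= r - Rabs (x - fst q)) by apply Rmin_l.
  assert (Hy : e <= r - Rabs (y - snd q)) by apply Rmin_r.
  apply (box_locally _ (x, y) e He); intros [x' y'] [H1' H2'];
    simpl in H1', H2'; split; simpl.
  - replace (x' - fst q) with ((x' - x) + (x - fst q)) by ring.
    eapply Rle_lt_trans; [apply Rabs_triang|]; lra.
  - replace (y' - snd q) with ((y' - y) + (y - snd q)) by ring.
    eapply Rle_lt_trans; [apply Rabs_triang|]; lra.
Qed.

Lemma continuous_box (f : R * R -> R) q eps :
  continuous f q -> 0 < eps ->
  exists r, 0 < r /\ forall p, box q r p -> Rabs (f p - f q) < eps.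
Proof.
  intros Hc He; apply locally_box.
  apply (Hc (fun y => Rabs (y - f q) < eps)).
  exists (mkposreal eps He); intros y Hy; exact Hy.
Qed.

Lemma is_derive_partial1 k D f (x y : R) :
  Ck_on (S k) D f -> D (x, y) ->
  is_derive (fun s => f (s, y)) x (partial1 f (x, y)).
Proof.
  intros H Dq; apply is_dderiv_R_is_derive.
  generalize (Ck_on_is_dderiv k D f (x, y) (1, 0) H Dq).
  apply is_derive_ext; intros t.
  change (f (x + t * 1, y + t * 0) = f (x + t * 1, y)).
  now replace (y + t * 0) with y by ring.
Qed.

Lemma is_derive_partial2 k D f (x y : R) :
  Ck_on (S k) D f -> D (x, y) ->
  is_derive (fun s => f (x, s)) y (partial2 f (x, y)).
Proof.
  intros H Dq; apply is_dderiv_R_is_derive.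
  generalize (Ck_on_is_dderiv k D f (x, y) (0, 1) H Dq).
  apply is_derive_ext; intros t.
  change (f (x + t * 0, y + t * 1) = f (x, y + t * 1)).
  now replace (x + t * 0) with x by ring.
Qed.

Lemma Rabs_between a b c x r :
  Rabs (a - x) < r -> Rabs (b - x) < r -> Rmin a b <= c <= Rmax a b ->
  Rabs (c - x) < r.
Proof.
  intros Ha Hb Hc.
  apply Rabs_def2 in Ha; apply Rabs_def2 in Hb.
  revert Hc; unfold Rmin, Rmax; destruct (Rle_dec a b); intros;
    apply Rabs_def1; lra.
Qed.

(** Both points vary: this uniform form makes Newton's map a contraction, and
    with one point fixed it is differentiability. *)
Lemma strict_differentiability D f (q : R * R) eps :
  open D -> Ck_on 1 D f -> D q -> 0 < eps ->
  exists r, 0 < r /\ forall p p', box q r p -> box q r p' ->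
    Rabs (f p' - f p - partial1 f q * (fst p' - fst p) - partial2 f q * (snd p' - snd p))
    <= eps * (Rabs (fst p' - fst p) + Rabs (snd p' - snd p)).
Proof.
  intros HD Hf Dq He.
  destruct (locally_box D q (HD q Dq)) as [r0 [Hr0 HB]].
  destruct (continuous_box (partial1 f) q eps) as [r1 [Hr1 HB1]]; auto.
  { apply (Ck_on_continuous 0 D); auto. apply Ck_on_dderiv; auto. }
  destruct (continuous_box (partial2 f) q eps) as [r2 [Hr2 HB2]]; auto.
  { apply (Ck_on_continuous 0 D); auto. apply Ck_on_dderiv; auto. }
  exists (Rmin r0 (Rmin r1 r2)); split; [repeat apply Rmin_glb_lt; auto|].
  intros [x y] [x' y'] Hp Hp'; simpl.
  assert (HM : forall p, box q (Rmin r0 (Rmin r1 r2)) p ->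
    D p /\ Rabs (partial1 f p - partial1 f q) < eps /\ Rabs (partial2 f p - partial2 f q) < eps).
  { intros p H; repeat split; [apply HB|apply HB1|apply HB2];
      revert H; apply box_le.
    - apply Rmin_l.
    - eapply Rle_trans; [apply Rmin_r|apply Rmin_l].
    - eapply Rle_trans; [apply Rmin_r|apply Rmin_r]. }
  set (r := Rmin r0 (Rmin r1 r2)) in *.
  destruct Hp as [Hx Hy], Hp' as [Hx' Hy']; simpl in *.
  (* The increment is split along the horizontal and the vertical segment. *)
  destruct (MVT_gen (fun s => f (s, y)) x x' (fun s => partial1 f (s, y)))
    as [c [Hc Ec]].
  1, 2: intros s Hs; assert (Ds : D (s, y)) by
    (apply HM; split; simpl; auto; apply (Rabs_between x x'); auto; lra).
  { apply (is_derive_partial1 0 D); auto. }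
  { apply derivable_continuous_pt; exists (partial1 f (s, y)); apply is_derive_Reals.
    apply (is_derive_partial1 0 D); auto. }
  destruct (MVT_gen (fun s => f (x', s)) y y' (fun s => partial2 f (x', s)))
    as [d [Hd Ed]].
  1, 2: intros s Hs; assert (Ds : D (x', s)) by
    (apply HM; split; simpl; auto; apply (Rabs_between y y'); auto; lra).
  { apply (is_derive_partial2 0 D); auto. }
  { apply derivable_continuous_pt; exists (partial2 f (x', s)); apply is_derive_Reals.
    apply (is_derive_partial2 0 D); auto. }
  assert (H1 : Rabs (partial1 f (c, y) - partial1 f q) < eps).
  { apply (HM (c, y)); split; simpl; [apply (Rabs_between x x')|]; assumption. }
  assert (H2 : Rabs (partial2 f (x', d) - partial2 f q) < eps).
  { apply (HM (x', d)); split; simpl; [|apply (Rabs_between y y')]; assumption. }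
  replace (f (x', y') - f (x, y) - partial1 f q * (x' - x) - partial2 f q * (y' - y))
    with ((partial1 f (c, y) - partial1 f q) * (x' - x) + (partial2 f (x', d) - partial2 f q) * (y' - y))
    by (replace (f (x', y') - f (x, y)) with
      ((f (x', y') - f (x', y)) + (f (x', y) - f (x, y))) by ring;
      rewrite Ec, Ed; ring).
  eapply Rle_trans; [apply Rabs_triang|]; rewrite !Rabs_mult.
  rewrite Rmult_plus_distr_l; apply Rplus_le_compat;
    apply Rmult_le_compat_r; try apply Rabs_pos; lra.
Qed.

(** The chain rule along a curve needs differentiability of [f] at one point
    only, which is what continuity of the two partial derivatives gives. *)
Lemma is_derive_curve D f (c1 c2 : R -> R) (t l1 l2 : R) :
  open D -> Ck_on 1 D f -> D (c1 t, c2 t) ->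
  is_derive c1 t l1 -> is_derive c2 t l2 ->
  is_derive (fun s => f (c1 s, c2 s)) t
    (l1 * partial1 f (c1 t, c2 t) + l2 * partial2 f (c1 t, c2 t)).
Proof.
  intros HD Hf Dq H1 H2.
  apply is_derive_Reals; rewrite (Rmult_comm l1), (Rmult_comm l2).
  apply (derivable_pt_lim_comp_2d (fun x y => f (x, y)) c1 c2);
    try apply is_derive_Reals; auto.
  intros [eps He]; simpl.
  destruct (strict_differentiability D f (c1 t, c2 t) (eps / 2) HD Hf Dq)
    as [r [Hr HB]]; [lra|].
  exists (mkposreal r Hr); intros u v Hu Hv; simpl in Hu, Hv.
  generalize (HB (c1 t, c2 t) (u, v) (box_center _ r Hr) (conj Hu Hv)); simpl.
  pose proof (Rmax_l (Rabs (u - c1 t)) (Rabs (v - c2 t))) as M1.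
  pose proof (Rmax_r (Rabs (u - c1 t)) (Rabs (v - c2 t))) as M2.
  set (M := Rmax _ _) in *.
  intros H; apply Rle_trans with (eps / 2 * (M + M)); [|right; field].
  replace (_ - _ - (_ + _)) with
    (f (u, v) - f (c1 t, c2 t) - partial1 f (c1 t, c2 t) * (u - c1 t)
     - partial2 f (c1 t, c2 t) * (v - c2 t)) by ring.
  eapply Rle_trans; [exact H|].
  apply Rmult_le_compat_l; lra.
Qed.

Lemma is_dderiv_comp2 {V : NormedModule R_AbsRing} D f (g h : V -> R)
    (p v : V) (a b : R) :
  open D -> Ck_on 1 D f -> D (g p, h p) ->
  is_dderiv g p v a -> is_dderiv h p v b ->
  is_dderiv (fun q => f (g q, h q)) p v
    (a * partial1 f (g p, h p) + b * partial2 f (g p, h p)).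
Proof.
  intros HD Hf Dp Hg Hh.
  pose proof (is_derive_curve D f (fun t => g (plus p (scal t v)))
    (fun t => h (plus p (scal t v))) 0 a b HD Hf) as H.
  cbv beta in H; rewrite !line_0 in H.
  apply H; auto.
Qed.

(** Membership in [Ck_on] only speaks of each direction separately; linearity in
    the direction comes from continuity of the partial derivatives. *)
Lemma dderiv_linear D f (p v : R * R) :
  open D -> Ck_on 1 D f -> D p ->
  dderiv f p v = fst v * partial1 f p + snd v * partial2 f p.
Proof.
  intros HD Hf Dp; apply is_dderiv_unique.
  destruct p as [x y], v as [v1 v2].
  apply (is_derive_ext (fun t : R => f (x + t * v1, y + t * v2)));
    [reflexivity|].
  pose proof (is_derive_curve D f (fun t => x + t * v1) (fun t => y + t * v2)
    0 v1 v2 HD Hf) as H.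
  cbv beta in H.
  replace (x + 0 * v1) with x in H by ring.
  replace (y + 0 * v2) with y in H by ring.
  apply H; auto; auto_derive; auto; ring.
Qed.

(** The derivative of a composite is a sum of products of derivatives and of
    composites with partial derivatives of [f], all of one order less. *)
Lemma Ck_on_comp2 {V : NormedModule R_AbsRing} k (U : V -> Prop) D f (g h : V -> R) :
  open U -> open D -> (forall p, U p -> D (g p, h p)) ->
  Ck_on k D f -> Ck_on k U g -> Ck_on k U h ->
  Ck_on k U (fun p => f (g p, h p)).
Proof.
  intros HU HD HUD.
  assert (Hc : forall f j, Ck_on j D f -> Ck_on j U g -> Ck_on j U h ->
    forall p, U p -> continuous (fun p => f (g p, h p)) p).
  { clear f; intros f j Hf Hg Hh p Up.
    apply (continuous_comp_2 g h (fun x y => f (x, y))).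
    - apply (Ck_on_continuous j U); auto.
    - apply (Ck_on_continuous j U); auto.
    - apply (continuous_ext f); [intros []; reflexivity|].
      apply (Ck_on_continuous j D); auto. }
  revert f; induction k as [|k IH]; intros f Hf Hg Hh.
  - split; auto. apply (Hc f 0%nat); auto.
  - apply (Ck_on_S k U _ (fun v p => dderiv g p v * partial1 f (g p, h p)
      + dderiv h p v * partial2 f (g p, h p))); auto.
    + apply (Hc f (S k)); auto.
    + intros v p Up; apply (is_dderiv_comp2 D f g h p v); auto.
      * clear - Hf; revert Hf; induction k; auto using Ck_on_pred.
      * apply (Ck_on_is_dderiv k U); auto.
      * apply (Ck_on_is_dderiv k U); auto.
    + intros v; apply Ck_on_plus; auto; apply Ck_on_mult; auto.
      * apply (Ck_on_dderiv k U g v); auto.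
      * apply (IH (partial1 f)); auto using Ck_on_pred.
        apply (Ck_on_dderiv k D f (1, 0)); auto.
      * apply (Ck_on_dderiv k U h v); auto.
      * apply (IH (partial2 f)); auto using Ck_on_pred.
        apply (Ck_on_dderiv k D f (0, 1)); auto.
Qed.

Lemma smooth_on_comp2 {V : NormedModule R_AbsRing} (U : V -> Prop) D f (g h : V -> R) :
  open U -> open D -> (forall p, U p -> D (g p, h p)) ->
  smooth_on D f -> smooth_on U g -> smooth_on U h ->
  smooth_on U (fun p => f (g p, h p)).
Proof. intros HU HD HUD Hf Hg Hh k; apply (Ck_on_comp2 k U D); auto. Qed.

Lemma smooth_on_partial1 D f : smooth_on D f -> smooth_on D (partial1 f).
Proof. apply (smooth_on_dderiv D f (1, 0)). Qed.

Lemma smooth_on_partial2 D f : smooth_on D f -> smooth_on D (partial2 f).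
Proof. apply (smooth_on_dderiv D f (0, 1)). Qed.

Lemma continuity_2d_pt_continuous (f : R * R -> R) x y :
  continuous f (x, y) -> continuity_2d_pt (fun u v => f (u, v)) x y.
Proof.
  intros Hc [e He].
  destruct (continuous_box f (x, y) e Hc He) as [r [Hr H]].
  exists (mkposreal r Hr); intros u v Hu Hv; apply H; split; auto.
Qed.

(** Schwarz's theorem, which plays the role of [d (d f) = 0]. *)
Lemma schwarz D f p : open D -> smooth_on D f -> D p -> partial1 (partial2 f) p = partial2 (partial1 f) p.
Proof.
  intros HD Hf Dp; destruct p as [x y].
  assert (H1 : forall g u v, smooth_on D g -> D (u, v) ->
    is_derive (fun s => g (s, v)) u (partial1 g (u, v))).
  { intros g u v Hg; apply (is_derive_partial1 0 D); auto. }
  assert (H2 : forall g u v, smooth_on D g -> D (u, v) ->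
    is_derive (fun s => g (u, s)) v (partial2 g (u, v))).
  { intros g u v Hg; apply (is_derive_partial2 0 D); auto. }
  assert (L1 : forall u v, D (u, v) -> locally u (fun s => D (s, v))).
  { intros u v Duv. destruct (locally_box D _ (HD _ Duv)) as [r [Hr HB]].
    exists (mkposreal r Hr); intros s Hs; apply HB; split; [exact Hs|].
    simpl; rewrite Rminus_diag, Rabs_R0; auto. }
  assert (L2 : forall u v, D (u, v) -> locally v (fun s => D (u, s))).
  { intros u v Duv. destruct (locally_box D _ (HD _ Duv)) as [r [Hr HB]].
    exists (mkposreal r Hr); intros s Hs; apply HB; split; [|exact Hs].
    simpl; rewrite Rminus_diag, Rabs_R0; auto. }
  assert (E12 : forall u v, D (u, v) ->
    is_derive (fun z => Derive (fun t => f (z, t)) v) u (partial1 (partial2 f) (u, v))).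
  { intros u v Duv; apply (is_derive_ext_loc (fun z => partial2 f (z, v))).
    - generalize (L1 u v Duv); apply filter_imp; intros z Dz.
      symmetry; apply is_derive_unique; auto.
    - auto using smooth_on_partial2. }
  assert (E21 : forall u v, D (u, v) ->
    is_derive (fun z => Derive (fun t => f (t, z)) u) v (partial2 (partial1 f) (u, v))).
  { intros u v Duv; apply (is_derive_ext_loc (fun z => partial1 f (u, z))).
    - generalize (L2 u v Duv); apply filter_imp; intros z Dz.
      symmetry; apply is_derive_unique; auto.
    - auto using smooth_on_partial1. }
  rewrite <- (is_derive_unique _ _ _ (E12 x y Dp)),
    <- (is_derive_unique _ _ _ (E21 x y Dp)).
  assert (HL : locally_2d (fun u v => D (u, v)) x y).
  { apply locally_2d_locally.
    generalize (HD (x, y) Dp); apply filter_imp; intros []; auto. }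
  apply (Schwarz (fun u v => f (u, v))).
  - revert HL; apply locally_2d_impl, locally_2d_forall; intros u v Duv.
    repeat split; eexists; eauto.
  - apply (continuity_2d_pt_ext_loc (fun u v => partial1 (partial2 f) (u, v))).
    + revert HL; apply locally_2d_impl, locally_2d_forall; intros u v Duv.
      symmetry; apply is_derive_unique; auto.
    + apply continuity_2d_pt_continuous.
      apply (smooth_on_continuous D); auto using smooth_on_partial1, smooth_on_partial2.
  - apply (continuity_2d_pt_ext_loc (fun u v => partial2 (partial1 f) (u, v))).
    + revert HL; apply locally_2d_impl, locally_2d_forall; intros u v Duv.
      symmetry; apply is_derive_unique; auto.
    + apply continuity_2d_pt_continuous.
      apply (smooth_on_continuous D); auto using smooth_on_partial1, smooth_on_partial2.
Qed.

(** * The inverse function theorem in the plane *)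

Definition dist1 (p q : R * R) : R := Rabs (fst q - fst p) + Rabs (snd q - snd p).

Lemma dist1_pos p q : 0 <= dist1 p q.
Proof. apply Rplus_le_le_0_compat; apply Rabs_pos. Qed.

Lemma dist1_triangle p q s : dist1 p s <= dist1 p q + dist1 q s.
Proof.
  unfold dist1.
  replace (fst s - fst p) with ((fst q - fst p) + (fst s - fst q)) by ring.
  replace (snd s - snd p) with ((snd q - snd p) + (snd s - snd q)) by ring.
  pose proof (Rabs_triang (fst q - fst p) (fst s - fst q)).
  pose proof (Rabs_triang (snd q - snd p) (snd s - snd q)).
  lra.
Qed.

Lemma dist1_0 p q : dist1 p q <= 0 -> p = q.
Proof.
  unfold dist1; intros H.
  pose proof (Rabs_pos (fst q - fst p)); pose proof (Rabs_pos (snd q - snd p)).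
  destruct p as [x y], q as [x' y']; simpl in *; f_equal.
  - assert (E : Rabs (x' - x) = 0) by lra.
    apply Rabs_eq_0 in E; lra.
  - assert (E : Rabs (y' - y) = 0) by lra.
    apply Rabs_eq_0 in E; lra.
Qed.

Lemma dist1_box p q r : dist1 p q < r -> box p r q.
Proof.
  unfold dist1; intros H.
  pose proof (Rabs_pos (fst q - fst p)); pose proof (Rabs_pos (snd q - snd p)).
  split; lra.
Qed.

(** Up to its first term, the sequence is a series of increments, which a
    geometric series dominates. *)
Lemma cauchy_geometric (x : nat -> R) C :
  (forall n, Rabs (x (S n) - x n) <= C * (1 / 2) ^ n) -> ex_finite_lim_seq x.
Proof.
  intros H.
  destruct (ex_series_le (fun n => x (S n) - x n) (fun n => C * (1 / 2) ^ n))
    as [l Hl].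
  - intros n; apply (H n).
  - apply (ex_series_scal_l C (fun n => (1 / 2) ^ n)).
    exists (/ (1 - 1 / 2)); apply is_series_geom; rewrite Rabs_pos_eq; lra.
  - exists (l + x O).
    apply is_lim_seq_incr_1.
    apply (is_lim_seq_ext (fun n => sum_n (fun n => x (S n) - x n) n + x O)).
    + intros n; induction n as [|n IH].
      * rewrite sum_O; ring.
      * rewrite sum_Sn; unfold plus; simpl; lra.
    + apply is_lim_seq_plus'; [exact Hl|apply is_lim_seq_const].
Qed.

(** The displacement [r / 4] at the centre keeps the whole orbit within [r / 2]
    of it, so a contraction of the open box suffices. *)
Lemma contraction_fixpoint (T : R * R -> R * R) p r :
  (forall q q', box p r q -> box p r q' -> dist1 (T q) (T q') <= 1 / 2 * dist1 q q') ->
  dist1 p (T p) < r / 4 ->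
  exists q, box p r q /\ T q = q.
Proof.
  intros HT H0.
  set (q := fun n => Nat.iter n T p).
  set (d := dist1 p (T p)) in *.
  assert (Hd : 0 <= d) by apply dist1_pos.
  assert (Hp : forall n, 0 < (1 / 2) ^ n) by (intros; apply pow_lt; lra).
  assert (HB : forall n, dist1 p (q n) <= 2 * d * (1 - (1 / 2) ^ n) /\
    dist1 (q n) (q (S n)) <= d * (1 / 2) ^ n).
  { induction n as [|n [IH1 IH2]].
    - simpl; split; [|fold d; lra].
      unfold dist1; rewrite !Rminus_diag, Rabs_R0; lra.
    - assert (H1 : dist1 p (q (S n)) <= 2 * d * (1 - (1 / 2) ^ S n)).
      { pose proof (dist1_triangle p (q n) (q (S n))); simpl pow; lra. }
      split; auto.
      change (q (S (S n))) with (T (q (S n))).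
      change (q (S n)) with (T (q n)) at 1.
      eapply Rle_trans; [apply HT; apply dist1_box|].
      + pose proof (Hp n); nra.
      + pose proof (Hp (S n)); nra.
      + simpl pow; lra. }
  assert (HB' : forall n, dist1 p (q n) <= 2 * d).
  { intros n; pose proof (Hp n); destruct (HB n); nra. }
  destruct (cauchy_geometric (fun n => fst (q n)) d) as [x Hx].
  { intros n; destruct (HB n) as [_ H]; unfold dist1 in H.
    pose proof (Rabs_pos (snd (q (S n)) - snd (q n))); lra. }
  destruct (cauchy_geometric (fun n => snd (q n)) d) as [y Hy].
  { intros n; destruct (HB n) as [_ H]; unfold dist1 in H.
    pose proof (Rabs_pos (fst (q (S n)) - fst (q n))); lra. }
  assert (HL : forall u, is_lim_seq (fun n => dist1 u (q n)) (dist1 u (x, y))).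
  { intros u; apply is_lim_seq_plus'.
    - apply (is_lim_seq_abs _ (x - fst u)); apply is_lim_seq_minus'; auto.
      apply is_lim_seq_const.
    - apply (is_lim_seq_abs _ (y - snd u)); apply is_lim_seq_minus'; auto.
      apply is_lim_seq_const. }
  assert (HBx : box p r (x, y)).
  { apply dist1_box; apply Rle_lt_trans with (2 * d); [|lra].
    apply (is_lim_seq_le (fun n => dist1 p (q n)) (fun _ => 2 * d)
      (dist1 p (x, y)) (2 * d)); auto using is_lim_seq_const. }
  exists (x, y); split; auto.
  apply dist1_0.
  (* Both [q (S n)] and [T (x, y)] lie close to [T (q n)]. *)
  apply (is_lim_seq_le (fun n => dist1 (T (x, y)) (q (S n)))
    (fun n => 1 / 2 * dist1 (x, y) (q n)) (dist1 (T (x, y)) (x, y)) 0).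
  - intros n; apply HT; auto.
    apply dist1_box; pose proof (HB' n); lra.
  - apply (is_lim_seq_incr_1 (fun n => dist1 (T (x, y)) (q n))); auto.
  - replace 0 with (1 / 2 * dist1 (x, y) (x, y))
      by (unfold dist1; rewrite !Rminus_diag, Rabs_R0; ring).
    apply (is_lim_seq_scal_l _ (1 / 2) (dist1 (x, y) (x, y))); auto.
Qed.

Definition jac (g1 g2 : R * R -> R) (p : R * R) : R :=
  partial1 g1 p * partial2 g2 p - partial2 g1 p * partial1 g2 p.

Lemma smooth_on_jac D g1 g2 :
  open D -> smooth_on D g1 -> smooth_on D g2 -> smooth_on D (jac g1 g2).
Proof.
  intros HD H1 H2; unfold jac.
  apply smooth_on_minus; auto; apply smooth_on_mult;
    auto using smooth_on_partial1, smooth_on_partial2.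
Qed.

(** By Cramer's rule, [s] is one of the unknowns of the linear system with rows
    [(a, b)], [(c, d)] and right-hand side [(e1, e2)]. *)
Lemma cramer_bound a b c d D s e1 e2 C eps S :
  D = a * d - b * c -> D <> 0 ->
  C = (Rabs a + Rabs b + Rabs c + Rabs d) / Rabs D ->
  s = (d * e1 - b * e2) / D \/ s = (a * e2 - c * e1) / D ->
  Rabs e1 <= eps * S -> Rabs e2 <= eps * S -> Rabs s <= C * eps * S.
Proof.
  intros ED HD EC Es H1 H2.
  assert (HD' : 0 < Rabs D) by now apply Rabs_pos_lt.
  assert (HeS : 0 <= eps * S) by (pose proof (Rabs_pos e1); lra).
  pose proof (Rabs_pos a); pose proof (Rabs_pos b).
  pose proof (Rabs_pos c); pose proof (Rabs_pos d).
  assert (G : forall u v f1 f2, Rabs f1 <= eps * S -> Rabs f2 <= eps * S ->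
    Rabs u + Rabs v <= Rabs a + Rabs b + Rabs c + Rabs d ->
    Rabs ((u * f1 - v * f2) / D) <= C * eps * S).
  { intros u v f1 f2 Hf1 Hf2 Huv.
    unfold Rdiv; rewrite Rabs_mult, Rabs_inv, EC.
    replace (_ / Rabs D * eps * S) with
      ((Rabs a + Rabs b + Rabs c + Rabs d) * (eps * S) * / Rabs D) by (field; lra).
    apply Rmult_le_compat_r; [left; now apply Rinv_0_lt_compat|].
    apply Rle_trans with ((Rabs u + Rabs v) * (eps * S));
      [|apply Rmult_le_compat_r; auto].
    unfold Rminus; eapply Rle_trans; [apply Rabs_triang|].
    rewrite Rabs_Ropp, !Rabs_mult, Rmult_plus_distr_r.
    apply Rplus_le_compat; apply Rmult_le_compat_l; auto using Rabs_pos. }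
  destruct Es as [-> | ->]; apply G; auto; lra.
Qed.

Section LocalInverse.
Variables (D : R * R -> Prop) (g1 g2 : R * R -> R) (p : R * R).
Hypotheses (HD : open D) (H1 : smooth_on D g1) (H2 : smooth_on D g2) (Dp : D p).
Hypothesis Hjac : jac g1 g2 p <> 0.

(** A bound for the entries of the inverse of the Jacobian matrix at [q]. *)
Definition inverse_norm (q : R * R) : R :=
  (Rabs (partial1 g1 q) + Rabs (partial2 g1 q) + Rabs (partial1 g2 q) + Rabs (partial2 g2 q))
  / Rabs (jac g1 g2 q).

Lemma inverse_norm_pos q : 0 <= inverse_norm q.
Proof.
  unfold inverse_norm, Rdiv; apply Rmult_le_pos.
  - repeat apply Rplus_le_le_0_compat; apply Rabs_pos.
  - destruct (Req_dec (jac g1 g2 q) 0) as [->|Hn].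
    + rewrite Rabs_R0, Rinv_0; lra.
    + left; apply Rinv_0_lt_compat; now apply Rabs_pos_lt.
Qed.

(** Newton's map with the derivative always taken at [p]; its fixed points
    solve [(g1 q, g2 q) = w]. *)
Definition newton (w q : R * R) : R * R :=
  (fst q - (partial2 g2 p * (g1 q - fst w) - partial2 g1 p * (g2 q - snd w)) / jac g1 g2 p,
   snd q - (partial1 g1 p * (g2 q - snd w) - partial1 g2 p * (g1 q - fst w)) / jac g1 g2 p).

Lemma newton_fixpoint w q : newton w q = q -> (g1 q, g2 q) = w.
Proof.
  destruct q as [x y], w as [w1 w2]; unfold newton; simpl; intros E.
  injection E; intros E2 E1.
  assert (F1 : partial2 g2 p * (g1 (x, y) - w1) - partial2 g1 p * (g2 (x, y) - w2) = 0).
  { apply Rmult_eq_reg_r with (/ jac g1 g2 p); [|now apply Rinv_neq_0_compat].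
    unfold Rdiv in E1; lra. }
  assert (F2 : partial1 g1 p * (g2 (x, y) - w2) - partial1 g2 p * (g1 (x, y) - w1) = 0).
  { apply Rmult_eq_reg_r with (/ jac g1 g2 p); [|now apply Rinv_neq_0_compat].
    unfold Rdiv in E2; lra. }
  f_equal; apply Rminus_diag_uniq.
  - apply Rmult_eq_reg_l with (jac g1 g2 p); auto; unfold jac; rewrite Rmult_0_r.
    transitivity (partial1 g1 p * 0 + partial2 g1 p * 0); [|ring].
    rewrite <- F1 at 1; rewrite <- F2; ring.
  - apply Rmult_eq_reg_l with (jac g1 g2 p); auto; unfold jac; rewrite Rmult_0_r.
    transitivity (partial1 g2 p * 0 + partial2 g2 p * 0); [|ring].
    rewrite <- F1 at 1; rewrite <- F2; ring.
Qed.

(** The derivative of [newton w] at [p] is zero whatever [w] is, so one box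
    serves all right-hand sides. *)
Lemma newton_contraction :
  exists r, 0 < r /\ (forall q, box p r q -> D q /\ jac g1 g2 q <> 0) /\
  forall w q q', box p r q -> box p r q' ->
    dist1 (newton w q) (newton w q') <= 1 / 2 * dist1 q q'.
Proof.
  pose proof (inverse_norm_pos p) as HC.
  set (C := inverse_norm p) in *.
  (* Each of the two components then contracts by a factor 1/4. *)
  set (eps := / (4 * (C + 1))).
  assert (He : 0 < eps) by (apply Rinv_0_lt_compat; lra).
  assert (HCe : C * eps <= 1 / 4).
  { unfold eps; apply Rmult_le_reg_r with (4 * (C + 1)); [lra|].
    rewrite Rmult_assoc, Rinv_l; lra. }
  destruct (locally_box D p (HD p Dp)) as [r0 [Hr0 HB0]].
  destruct (continuous_box (jac g1 g2) p (Rabs (jac g1 g2 p))) as [r1 [Hr1 HB1]].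
  { apply (smooth_on_continuous D); auto using smooth_on_jac. }
  { now apply Rabs_pos_lt. }
  destruct (strict_differentiability D g1 p eps HD (H1 1%nat) Dp He)
    as [r2 [Hr2 HB2]].
  destruct (strict_differentiability D g2 p eps HD (H2 1%nat) Dp He)
    as [r3 [Hr3 HB3]].
  set (r := Rmin (Rmin r0 r1) (Rmin r2 r3)).
  assert (L0 : r <= r0) by (eapply Rle_trans; [apply Rmin_l|apply Rmin_l]).
  assert (L1 : r <= r1) by (eapply Rle_trans; [apply Rmin_l|apply Rmin_r]).
  assert (L2 : r <= r2) by (eapply Rle_trans; [apply Rmin_r|apply Rmin_l]).
  assert (L3 : r <= r3) by (eapply Rle_trans; [apply Rmin_r|apply Rmin_r]).
  exists r; split; [repeat apply Rmin_glb_lt; auto|split].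
  - intros q Hq; split; [apply HB0; eapply box_le; eauto|].
    intros E; assert (Hq1 : box p r1 q) by (eapply box_le; eauto).
    apply HB1 in Hq1; rewrite E, Rminus_0_l, Rabs_Ropp in Hq1; lra.
  - intros w q q' Hq Hq'.
    pose proof (HB2 q q' (box_le _ _ _ _ L2 Hq) (box_le _ _ _ _ L2 Hq')) as E1.
    pose proof (HB3 q q' (box_le _ _ _ _ L3 Hq) (box_le _ _ _ _ L3 Hq')) as E2.
    fold (dist1 q q') in E1, E2.
    set (e1 := g1 q' - _ - _ - _) in E1; set (e2 := g2 q' - _ - _ - _) in E2.
    assert (B : forall s,
      s = (partial2 g2 p * e1 - partial2 g1 p * e2) / jac g1 g2 p \/
      s = (partial1 g1 p * e2 - partial1 g2 p * e1) / jac g1 g2 p ->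
      Rabs s <= 1 / 4 * dist1 q q').
    { intros s Hs; apply Rle_trans with (C * eps * dist1 q q').
      - apply (cramer_bound (partial1 g1 p) (partial2 g1 p) (partial1 g2 p) (partial2 g2 p)
          (jac g1 g2 p) s e1 e2); auto.
      - apply Rmult_le_compat_r; auto using dist1_pos. }
    replace (1 / 2 * dist1 q q') with (1 / 4 * dist1 q q' + 1 / 4 * dist1 q q') by field.
    unfold dist1 at 1, newton; simpl; apply Rplus_le_compat;
      rewrite <- Rabs_Ropp; apply B; [left|right];
      unfold e1, e2; apply Rmult_eq_reg_r with (jac g1 g2 p); auto;
      unfold Rdiv; rewrite (Rmult_assoc _ (/ jac g1 g2 p)), Rinv_l, Rmult_1_r; auto.
    + match goal with |- ?L = ?R =>
        replace L with (- (fst q' - fst q) * jac g1 g2 p + (partial2 g2 p * (g1 q' - g1 q) - partial2 g1 p * (g2 q' - g2 q))) by (field; auto) end.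
      unfold jac; ring.
    + match goal with |- ?L = ?R =>
        replace L with (- (snd q' - snd q) * jac g1 g2 p + (partial1 g1 p * (g2 q' - g2 q) - partial1 g2 p * (g1 q' - g1 q))) by (field; auto) end.
      unfold jac; ring.
Qed.

(** Together with [newton_contraction] this makes the solution Lipschitz in the
    right-hand side. *)
Lemma newton_displacement w w' q :
  dist1 (newton w q) (newton w' q) <= 2 * inverse_norm p * dist1 w w'.
Proof.
  replace (2 * inverse_norm p * dist1 w w') with
    (inverse_norm p * 1 * dist1 w w' + inverse_norm p * 1 * dist1 w w') by ring.
  assert (Hw1 : Rabs (fst w' - fst w) <= 1 * dist1 w w').
  { unfold dist1; pose proof (Rabs_pos (snd w' - snd w)); lra. }
  assert (Hw2 : Rabs (snd w' - snd w) <= 1 * dist1 w w').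
  { unfold dist1; pose proof (Rabs_pos (fst w' - fst w)); lra. }
  unfold dist1 at 1; apply Rplus_le_compat;
    apply (cramer_bound (partial1 g1 p) (partial2 g1 p) (partial1 g2 p) (partial2 g2 p)
      (jac g1 g2 p) _ (fst w' - fst w) (snd w' - snd w)); auto;
    [left|right]; unfold newton; simpl; field; auto.
Qed.

Lemma newton_solution q : newton (g1 q, g2 q) q = q.
Proof.
  destruct q as [x y]; unfold newton; simpl; f_equal; rewrite !Rminus_diag;
    unfold Rdiv; ring.
Qed.

End LocalInverse.

(** A Lipschitz right inverse is differentiable, and Cramer's rule expresses its
    derivative through the inverse itself; this formula then raises the order of
    smoothness of the inverse step by step. *)
Lemma inverse_is_dderiv D g1 g2 (W : R * R -> Prop) (k : R * R -> R * R) L w v :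
  open D -> smooth_on D g1 -> smooth_on D g2 -> open W ->
  (forall w, W w -> D (k w) /\ (g1 (k w), g2 (k w)) = w) ->
  (forall w w', W w -> W w' -> dist1 (k w) (k w') <= L * dist1 w w') ->
  W w -> jac g1 g2 (k w) <> 0 ->
  is_dderiv (fun w => fst (k w)) w v
    ((fst v * partial2 g2 (k w) - snd v * partial2 g1 (k w)) / jac g1 g2 (k w)) /\
  is_dderiv (fun w => snd (k w)) w v
    ((snd v * partial1 g1 (k w) - fst v * partial1 g2 (k w)) / jac g1 g2 (k w)).
Proof.
  intros HD H1 H2 HW Hk HL Ww Hj.
  set (q := k w) in *.
  assert (Dq : D q) by apply (Hk w Ww).
  pose proof (inverse_norm_pos g1 g2 q) as HC.
  set (C := inverse_norm g1 g2 q) in *.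
  set (S := Rmax L 0 * (Rabs (fst v) + Rabs (snd v))).
  assert (HV : 0 <= Rabs (fst v) + Rabs (snd v))
    by (apply Rplus_le_le_0_compat; apply Rabs_pos).
  assert (HS : 0 <= S) by (apply Rmult_le_pos; auto using Rmax_r).
  set (kt := fun t : R => k (plus w (scal t v))).
  assert (Hkt : forall eps, 0 < eps -> exists d : posreal, forall t, Rabs t < d ->
    W (plus w (scal t v)) /\ dist1 q (kt t) <= S * Rabs t /\
    Rabs (g1 (kt t) - g1 q - partial1 g1 q * (fst (kt t) - fst q)
      - partial2 g1 q * (snd (kt t) - snd q)) <= eps * dist1 q (kt t) /\
    Rabs (g2 (kt t) - g2 q - partial1 g2 q * (fst (kt t) - fst q)
      - partial2 g2 q * (snd (kt t) - snd q)) <= eps * dist1 q (kt t)).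
  { intros eps He.
    destruct (strict_differentiability D g1 q eps HD (H1 1%nat) Dq He)
      as [r1 [Hr1 HB1]].
    destruct (strict_differentiability D g2 q eps HD (H2 1%nat) Dq He)
      as [r2 [Hr2 HB2]].
    destruct (locally_line W w v HW Ww) as [d0 Hd0].
    set (r := Rmin r1 r2).
    assert (Hr : 0 < r) by (apply Rmin_glb_lt; auto).
    assert (Hd : 0 < Rmin d0 (r / (S + 1))).
    { apply Rmin_glb_lt; [apply cond_pos|apply Rdiv_lt_0_compat; lra]. }
    exists (mkposreal _ Hd); intros t Ht; simpl in Ht.
    assert (Wt : W (plus w (scal t v))).
    { apply Hd0. change (Rabs (t - 0) < d0). rewrite Rminus_0_r.
      eapply Rlt_le_trans; [exact Ht|apply Rmin_l]. }
    assert (Hq : dist1 q (kt t) <= S * Rabs t).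
    { eapply Rle_trans; [apply (HL w _ Ww Wt)|].
      assert (E : dist1 w (plus w (scal t v)) =
        Rabs t * (Rabs (fst v) + Rabs (snd v))).
      { rewrite Rmult_plus_distr_l, <- !Rabs_mult.
        destruct w as [w1 w2], v as [v1 v2].
        change (Rabs (w1 + t * v1 - w1) + Rabs (w2 + t * v2 - w2) =
          Rabs (t * v1) + Rabs (t * v2)).
        f_equal; f_equal; ring. }
      rewrite E; unfold S.
      replace (Rmax L 0 * (Rabs (fst v) + Rabs (snd v)) * Rabs t) with
        (Rmax L 0 * (Rabs t * (Rabs (fst v) + Rabs (snd v)))) by ring.
      apply Rmult_le_compat_r; [|apply Rmax_l].
      apply Rmult_le_pos; auto using Rabs_pos. }
    assert (Hbox : box q r (kt t)).
    { apply dist1_box; apply Rle_lt_trans with (1 := Hq).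
      apply Rle_lt_trans with ((S + 1) * Rabs t).
      - apply Rmult_le_compat_r; [apply Rabs_pos|lra].
      - apply Rlt_le_trans with ((S + 1) * (r / (S + 1))).
        + apply Rmult_lt_compat_l; [lra|].
          eapply Rlt_le_trans; [exact Ht|apply Rmin_r].
        + right; field; lra. }
    repeat split; auto.
    - apply HB1; [now apply box_center|].
      revert Hbox; apply box_le, Rmin_l.
    - apply HB2; [now apply box_center|].
      revert Hbox; apply box_le, Rmin_r. }
  assert (Hg : forall t, W (plus w (scal t v)) ->
    g1 (kt t) - g1 q = t * fst v /\ g2 (kt t) - g2 q = t * snd v).
  { intros t Wt; destruct (Hk _ Wt) as [_ E]; destruct (Hk w Ww) as [_ E0].
    fold q in E0; fold (kt t) in E.
    assert (F1 : g1 q = fst w) by now rewrite <- E0.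
    assert (F2 : g2 q = snd w) by now rewrite <- E0.
    assert (G1 : g1 (kt t) = fst (plus w (scal t v))) by now rewrite <- E.
    assert (G2 : g2 (kt t) = snd (plus w (scal t v))) by now rewrite <- E.
    rewrite F1, F2, G1, G2; destruct w as [w1 w2], v as [v1 v2].
    change (w1 + t * v1 - w1 = t * v1 /\ w2 + t * v2 - w2 = t * v2).
    split; ring. }
  assert (Hkey : forall eps, 0 < eps -> exists d : posreal,
    forall t, t <> 0 -> Rabs t < d ->
    Rabs ((fst (kt t) - fst q) / t -
      (fst v * partial2 g2 q - snd v * partial2 g1 q) / jac g1 g2 q) < eps /\
    Rabs ((snd (kt t) - snd q) / t -
      (snd v * partial1 g1 q - fst v * partial1 g2 q) / jac g1 g2 q) < eps).
  { intros eps He.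
    assert (HCS : 0 <= C * S) by (apply Rmult_le_pos; auto).
    set (eps' := eps / (C * S + 1)).
    assert (He' : 0 < eps') by (apply Rdiv_lt_0_compat; lra).
    assert (Hlt : C * eps' * S < eps).
    { unfold eps'; apply Rmult_lt_reg_r with (C * S + 1); [lra|].
      replace (C * (eps / (C * S + 1)) * S * (C * S + 1)) with (C * S * eps)
        by (field; lra). nra. }
    destruct (Hkt eps' He') as [d Hd].
    exists d; intros t Ht0 Ht.
    destruct (Hd t Ht) as [Wt [Hq [E1 E2]]].
    destruct (Hg t Wt) as [G1 G2]; rewrite G1 in E1; rewrite G2 in E2.
    set (e1 := t * fst v - _ - _) in E1; set (e2 := t * snd v - _ - _) in E2.
    assert (Habs : 0 < Rabs t) by now apply Rabs_pos_lt.
    assert (B : forall s,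
      - t * s = (partial2 g2 q * e1 - partial2 g1 q * e2) / jac g1 g2 q \/
      - t * s = (partial1 g1 q * e2 - partial1 g2 q * e1) / jac g1 g2 q ->
      Rabs s < eps).
    { intros s Hs; apply Rmult_lt_reg_l with (Rabs t); auto.
      rewrite <- Rabs_mult, <- Rabs_Ropp, <- Ropp_mult_distr_l_reverse.
      apply Rle_lt_trans with (C * eps' * (S * Rabs t)).
      - assert (M : eps' * dist1 q (kt t) <= eps' * (S * Rabs t))
          by (apply Rmult_le_compat_l; lra).
        apply (cramer_bound (partial1 g1 q) (partial2 g1 q) (partial1 g2 q)
          (partial2 g2 q) (jac g1 g2 q) _ e1 e2); auto; lra.
      - rewrite <- Rmult_assoc, (Rmult_comm (Rabs t)).
        apply Rmult_lt_compat_r; auto. }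
    split; apply B; [left|right]; unfold e1, e2, jac; field; auto. }
  split; apply is_derive_Reals; intros eps He;
    destruct (Hkey eps He) as [d Hd]; exists d; intros t Ht0 Ht;
    rewrite Rplus_0_l; rewrite line_0; apply (Hd t Ht0 Ht).
Qed.

(** The target is a whole box, so that the two coordinates range independently
    over intervals. *)
Lemma inverse_function D g1 g2 p :
  open D -> smooth_on D g1 -> smooth_on D g2 -> D p -> jac g1 g2 p <> 0 ->
  exists (U : R * R -> Prop) r, 0 < r /\ open U /\ U p /\
    (forall q, U q -> D q /\ jac g1 g2 q <> 0) /\
    diffeomorphism2 U (box (g1 p, g2 p) r) (fun q => (g1 q, g2 q)).
Proof.
  intros HD H1 H2 Dp Hj.
  destruct (newton_contraction D g1 g2 p HD H1 H2 Dp Hj) as [r [Hr [HDr HN]]].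
  pose proof (inverse_norm_pos g1 g2 p) as HC.
  set (C := inverse_norm g1 g2 p) in *.
  (* Newton's map for a point of the box of radius [rho] moves [p] by at most
     [4 * C * rho < r / 4]. *)
  set (rho := r / (16 * (C + 1))).
  assert (Hrho : 0 < rho) by (apply Rdiv_lt_0_compat; lra).
  assert (Hdisp : forall w w' q q', box p r q -> box p r q' ->
    (g1 q, g2 q) = w -> (g1 q', g2 q') = w' ->
    dist1 q q' <= 4 * C * dist1 w w').
  { intros w w' q q' Hq Hq' E E'.
    pose proof (newton_solution g1 g2 p q) as F; rewrite E in F.
    pose proof (newton_solution g1 g2 p q') as F'; rewrite E' in F'.
    pose proof (newton_displacement g1 g2 p Hj w w' q') as B; fold C in B.
    rewrite F' in B.
    pose proof (HN w q q' Hq Hq') as B'; rewrite F in B'.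
    pose proof (dist1_triangle q (newton g1 g2 p w q') q'); lra. }
  assert (Hsol : forall w, exists q, box (g1 p, g2 p) rho w ->
    box p r q /\ (g1 q, g2 q) = w).
  { intros w; destruct (classic (box (g1 p, g2 p) rho w)) as [Hw|Hw];
      [|exists p; contradiction].
    destruct (contraction_fixpoint (newton g1 g2 p w) p r) as [q [Hq Eq]]; auto.
    - pose proof (newton_displacement g1 g2 p Hj (g1 p, g2 p) w p) as B; fold C in B.
      rewrite newton_solution in B.
      eapply Rle_lt_trans; [exact B|].
      assert (dist1 (g1 p, g2 p) w < 2 * rho) by
        (destruct Hw; unfold dist1; lra).
      assert (16 * (C + 1) * rho = r) by (unfold rho; field; lra).
      pose proof (dist1_pos (g1 p, g2 p) w); nra.
    - exists q; intros _; split; auto.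
      apply (newton_fixpoint g1 g2 p); auto. }
  set (k := fun w => proj1_sig (constructive_indefinite_description _ (Hsol w))).
  assert (Hk : forall w, box (g1 p, g2 p) rho w ->
    box p r (k w) /\ (g1 (k w), g2 (k w)) = w).
  { intros w; unfold k; destruct (constructive_indefinite_description _ (Hsol w)); auto. }
  assert (HL : forall w w', box (g1 p, g2 p) rho w -> box (g1 p, g2 p) rho w' ->
    dist1 (k w) (k w') <= 4 * C * dist1 w w').
  { intros w w' Hw Hw'; apply Hdisp; apply Hk; auto. }
  set (W := box (g1 p, g2 p) rho) in *.
  assert (HW : open W) by apply open_box.
  set (U := fun q => box p r q /\ W (g1 q, g2 q)).
  assert (HU : open U).
  { intros q [Hq Wq]; apply filter_and; [now apply open_box|].
    destruct (HDr q Hq) as [Dq _].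
    assert (Hcont : continuous (fun q => (g1 q, g2 q)) q).
    { apply (continuous_comp_2 g1 g2 (fun x y => (x, y))).
      - apply (smooth_on_continuous D); auto.
      - apply (smooth_on_continuous D); auto.
      - apply (continuous_ext (fun x => x)); [intros []; reflexivity|].
        apply continuous_id. }
    apply (Hcont W); apply HW; auto. }
  exists U, rho; split; [auto|split; [auto|split; [|split]]].
  - split; now apply box_center.
  - intros q [Hq _]; auto.
  - exists k; split; [|split; [|split]].
    + split; apply (smooth_on_subset D); auto; intros q [Hq _]; apply HDr; auto.
    + assert (HkD : forall w, W w -> D (k w) /\ jac g1 g2 (k w) <> 0)
        by (intros w Ww; apply HDr, Hk; auto).
      assert (Hd : forall w v, W w -> _) by
        (intros w v Ww; apply (inverse_is_dderiv D g1 g2 W k (4 * C) w v HD H1 H2 HW);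
          auto; [intros w' Ww'; split; [apply HkD|apply Hk]; auto|apply HkD; auto]).
      cbv beta in Hd.
      assert (Hcont : forall w, W w ->
        continuous (fun w => fst (k w)) w /\ continuous (fun w => snd (k w)) w).
      { intros w Ww; split; apply filterlim_locally; intros [e He].
        all: apply (filter_imp (fun w' => W w' /\ box w (e / (8 * C + 1)) w')).
        2, 4: apply filter_and; [now apply HW|apply open_box, box_center;
          apply Rdiv_lt_0_compat; lra].
        all: intros w' [Ww' [B1 B2]]; simpl.
        all: assert (B : dist1 (k w) (k w') < e).
        1, 3: apply Rle_lt_trans with (1 := HL w w' Ww Ww');
          assert (dist1 w w' < 2 * (e / (8 * C + 1))) by (unfold dist1; lra);
          assert ((8 * C + 1) * (e / (8 * C + 1)) = e) by (field; lra);
          pose proof (dist1_pos w w'); nra.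
        all: apply dist1_box in B; apply B. }
      assert (HCk : forall n, Ck_on n W (fun w => fst (k w)) /\
        Ck_on n W (fun w => snd (k w))).
      { induction n as [|n [IH1 IH2]].
        - split; split; auto; apply Hcont.
        - assert (HC2 : forall f, smooth_on D f -> Ck_on n W (fun w => f (k w))).
          { intros f Hf; apply (Ck_on_ext n W (fun w => f (fst (k w), snd (k w)))); auto.
            - intros w _; now rewrite <- surjective_pairing.
            - apply (Ck_on_comp2 n W D); auto.
              intros w Ww; rewrite <- surjective_pairing; apply HkD; auto. }
          assert (HCj : Ck_on n W (fun w => / jac g1 g2 (k w))).
          { apply (Ck_on_comp1 n W (fun x => x <> 0) Rinv); auto.
            - apply open_neq.
            - intros w Ww; apply HkD; auto.
            - apply smooth_inv.
            - apply HC2, smooth_on_jac; auto. }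
          assert (HCv : forall (a b : R) f g, smooth_on D f -> smooth_on D g ->
            Ck_on n W (fun w => (a * f (k w) - b * g (k w)) / jac g1 g2 (k w))).
          { intros a b f g Hf Hg.
            apply (Ck_on_mult n W (fun w => a * f (k w) - b * g (k w))); auto.
            apply (HC2 (fun q => a * f q - b * g q)).
            apply smooth_on_minus; auto; apply smooth_on_mult;
              auto using smooth_on_const. }
          split.
          + apply (Ck_on_S n W _ (fun v w => (fst v * partial2 g2 (k w)
              - snd v * partial2 g1 (k w)) / jac g1 g2 (k w))); auto.
            * intros w Ww; apply Hcont; auto.
            * intros v w Ww; exact (proj1 (Hd w v Ww)).
            * intros v; apply HCv; auto using smooth_on_partial2.
          + apply (Ck_on_S n W _ (fun v w => (snd v * partial1 g1 (k w)
              - fst v * partial1 g2 (k w)) / jac g1 g2 (k w))); auto.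
            * intros w Ww; apply Hcont; auto.
            * intros v w Ww; exact (proj2 (Hd w v Ww)).
            * intros v; apply HCv; auto using smooth_on_partial1. }
      split; intros n; apply HCk.
    + intros q [Hq Wq]; split; auto.
      apply dist1_0.
      eapply Rle_trans; [apply (Hdisp (g1 q, g2 q) (g1 q, g2 q)); auto; apply Hk; auto|].
      unfold dist1; simpl; rewrite !Rminus_diag, Rabs_R0; lra.
    + intros w Ww; destruct (Hk w Ww) as [Hq E]; split; auto.
      split; auto; now rewrite E.
Qed.

(** * Maps of rank one in the plane *)

Lemma dderiv_comp1 {V : NormedModule R_AbsRing} (U : V -> Prop) (D : R -> Prop)
    phi (f g : V -> R) p v :
  open U -> smooth_on U f -> smooth_on D phi -> (forall p, U p -> D (f p)) ->
  (forall p, U p -> g p = phi (f p)) -> U p ->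
  dderiv g p v = dderiv f p v * Derive phi (f p).
Proof.
  intros HU Hf Hphi HD E Up; apply is_dderiv_unique.
  apply (is_derive_ext_loc (fun t : R => phi (f (plus p (scal t v))))).
  - generalize (locally_line U p v HU Up); apply filter_imp.
    intros t Ut; symmetry; apply E; auto.
  - apply is_dderiv_comp1.
    + apply (smooth_on_is_derive D); auto.
    + apply (smooth_on_is_dderiv U); auto.
Qed.

(** A linear map of rank at most one on the plane has a kernel; the explicit
    vector is a rotated gradient of whichever function is not critical. *)
Lemma jac_zero_kernel D g1 g2 p :
  open D -> smooth_on D g1 -> smooth_on D g2 -> D p -> jac g1 g2 p = 0 ->
  exists v : R * R, v <> zero /\ dderiv g1 p v = 0 /\ dderiv g2 p v = 0.
Proof.
  intros HD H1 H2 Dp; unfold jac.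
  assert (L1 : forall v, dderiv g1 p v = fst v * partial1 g1 p + snd v * partial2 g1 p)
    by (intros; apply (dderiv_linear D); auto).
  assert (L2 : forall v, dderiv g2 p v = fst v * partial1 g2 p + snd v * partial2 g2 p)
    by (intros; apply (dderiv_linear D); auto).
  set (a := partial1 g1 p) in *; set (b := partial2 g1 p) in *.
  set (c := partial1 g2 p) in *; set (d := partial2 g2 p) in *.
  intros E.
  assert (Hz : forall u v : R, u <> 0 \/ v <> 0 -> (u, v) <> (zero : R * R)).
  { intros u v Huv F; injection F; unfold Hierarchy.zero; simpl; tauto. }
  destruct (Req_dec a 0) as [Ea|Ha]; [destruct (Req_dec b 0) as [Eb|Hb]|].
  - destruct (Req_dec c 0) as [Ec|Hc]; [destruct (Req_dec d 0) as [Ed|Hd]|].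
    + exists (1, 0); rewrite L1, L2; simpl; split; [apply Hz; lra|].
      rewrite Ea, Eb, Ec, Ed; split; ring.
    + exists (- d, c); rewrite L1, L2; simpl; split; [apply Hz; lra|].
      rewrite Ea, Eb; split; ring.
    + exists (- d, c); rewrite L1, L2; simpl; split; [apply Hz; lra|].
      rewrite Ea, Eb; split; ring.
  - exists (- b, a); rewrite L1, L2; simpl; split; [apply Hz; lra|].
    split; lra.
  - exists (- b, a); rewrite L1, L2; simpl; split; [apply Hz; lra|].
    split; lra.
Qed.

Lemma open_interval_oo a b : open (interval_oo a b).
Proof.
  apply open_and; [apply open_Rbar_gt|apply open_Rbar_lt].
Qed.

Lemma interval_oo_center (c r s : R) :
  interval_oo (c - r) (c + r) s <-> Rabs (s - c) < r.
Proof.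
  unfold interval_oo; simpl; split.
  - intros; apply Rabs_def1; lra.
  - intros H; apply Rabs_def2 in H; lra.
Qed.

(** In the coordinates [(g1, g2)] the derivative of [f] in the first direction
    vanishes, so [f] depends on [g2] alone. *)
Lemma factor_through_second U g1 g2 f c r :
  open U -> smooth_on U f -> smooth_on U g2 ->
  diffeomorphism2 U (box c r) (fun q => (g1 q, g2 q)) -> 0 < r ->
  (forall q v, U q -> dderiv g2 q v = 0 -> dderiv f q v = 0) ->
  exists phi, smooth_on (interval_oo (snd c - r) (snd c + r)) phi /\
    forall q, U q -> f q = phi (g2 q).
Proof.
  intros HU Hf Hg2 [k [_ [[Hk1 Hk2] [Hg Hk]]]] Hr Hker.
  set (W := box c r) in *.
  assert (HW : open W) by apply open_box.
  assert (HkU : forall w, W w -> U (fst (k w), snd (k w)))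
    by (intros w Ww; rewrite <- surjective_pairing; apply Hk; auto).
  assert (Hcomp : forall h, smooth_on U h ->
    smooth_on W (fun w => h (fst (k w), snd (k w))))
    by (intros h Hh; apply (smooth_on_comp2 W U); auto).
  assert (Hchain : forall h w, smooth_on U h -> W w ->
    dderiv (fun w => h (fst (k w), snd (k w))) w (1, 0) =
    dderiv h (k w) (partial1 (fun w => fst (k w)) w, partial1 (fun w => snd (k w)) w)).
  { intros h w Hh Ww; apply is_dderiv_unique.
    rewrite (dderiv_linear U); auto; [|apply Hk; auto].
    pose proof (is_dderiv_comp2 U h (fun w => fst (k w)) (fun w => snd (k w)) w (1, 0)
      (partial1 (fun w => fst (k w)) w) (partial1 (fun w => snd (k w)) w) HU (Hh 1%nat)
      (HkU w Ww)) as H.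
    cbv beta in H; rewrite <- surjective_pairing in H; apply H.
    - apply (smooth_on_is_dderiv W); auto.
    - apply (smooth_on_is_dderiv W); auto. }
  set (F := fun w => f (fst (k w), snd (k w))).
  assert (HF : smooth_on W F) by (apply Hcomp; auto).
  assert (HF0 : forall w, W w -> partial1 F w = 0).
  { intros w Ww; unfold partial1, F; rewrite Hchain; auto.
    apply Hker; [apply Hk; auto|].
    rewrite <- Hchain; auto.
    apply is_dderiv_unique.
    apply (is_derive_ext_loc (fun _ => snd w)).
    - generalize (locally_line W w (1, 0) HW Ww); apply filter_imp; intros t Wt.
      rewrite <- surjective_pairing.
      destruct (Hk _ Wt) as [_ E].
      transitivity (snd (plus w (scal t (1, 0)))); [|exact (eq_sym (f_equal snd E))].
      change (snd w = snd w + t * 0); ring.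
    - apply (is_dderiv_const (snd w) w (1, 0)). }
  exists (fun s => F (fst c, s)); split.
  - apply (smooth_on_comp2 _ W); auto using open_interval_oo.
    + intros s Hs; split; simpl.
      * rewrite Rminus_diag, Rabs_R0; auto.
      * now apply interval_oo_center.
    + apply (smooth_on_const (interval_oo (snd c - r) (snd c + r)) (fst c)).
      apply open_interval_oo.
    + apply smooth_on_id, open_interval_oo.
  - intros q Uq; destruct (Hg q Uq) as [Wq Eq].
    destruct (MVT_gen (fun s => F (s, g2 q)) (fst c) (g1 q)
      (fun s => partial1 F (s, g2 q))) as [d [Hd E]].
    1, 2: intros s Hs; assert (Ws : W (s, g2 q)) by
      (split; [|apply Wq]; simpl; apply (Rabs_between (fst c) (g1 q));
       [rewrite Rminus_diag, Rabs_R0; auto|apply Wq|simpl in *; lra]).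
    + apply (is_derive_partial1 0 W); auto.
    + apply derivable_continuous_pt; exists (partial1 F (s, g2 q)).
      apply is_derive_Reals, (is_derive_partial1 0 W); auto.
    + rewrite HF0, Rmult_0_l in E.
      * transitivity (F (g1 q, g2 q)); [|simpl in *; lra].
        unfold F; now rewrite Eq, <- surjective_pairing.
      * split; [|apply Wq]; simpl; apply (Rabs_between (fst c) (g1 q));
          [rewrite Rminus_diag, Rabs_R0; auto|apply Wq|auto].
Qed.

(** [L] is the integral of the speed of [(g1, g2)] divided by [s]; with [L] as
    parameter the curve has constant speed [s]. *)
Lemma arclength (alpha beta s0 : R) g1 g2 (s : R) :
  0 < s -> interval_oo alpha beta s0 ->
  smooth_on (interval_oo alpha beta) g1 -> smooth_on (interval_oo alpha beta) g2 ->
  (forall t, interval_oo alpha beta t -> Derive g1 t <> 0 \/ Derive g2 t <> 0) ->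
  exists L, smooth_on (interval_oo alpha beta) L /\
    forall t, interval_oo alpha beta t ->
      0 < Derive L t /\ Derive g1 t ^ 2 + Derive g2 t ^ 2 = (s * Derive L t) ^ 2.
Proof.
  intros Hs Hs0 H1 H2 Hreg.
  set (I := interval_oo alpha beta) in *.
  assert (HI : open I) by apply open_interval_oo.
  set (n := fun t => Derive g1 t * Derive g1 t + Derive g2 t * Derive g2 t).
  assert (Hn : forall t, I t -> 0 < n t).
  { intros t It; unfold n.
    pose proof (Rle_0_sqr (Derive g1 t)) as P1; pose proof (Rle_0_sqr (Derive g2 t)) as P2.
    unfold Rsqr in *.
    destruct (Hreg t It) as [E|E]; apply Rsqr_pos_lt in E; unfold Rsqr in E; lra. }
  set (S := fun t => / s * sqrt (n t)).
  assert (HS : smooth_on I S).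
  { apply (smooth_on_mult I (fun _ => / s)); auto using smooth_on_const.
    apply (smooth_on_comp1 I (fun x => 0 < x) sqrt n); auto using smooth_sqrt.
    - apply open_gt.
    - apply smooth_on_plus; auto; apply smooth_on_mult; auto using smooth_on_Derive. }
  assert (HL : forall t, I t -> is_derive (fun t => RInt S s0 t) t (S t)).
  { intros t It; apply (is_derive_RInt S _ s0).
    - generalize (HI t It); apply filter_imp; intros u Iu.
      apply (@RInt_correct R_CompleteNormedModule).
      apply (@ex_RInt_continuous R_CompleteNormedModule); intros w Hw.
      apply (smooth_on_continuous I S w HS).
      unfold I, interval_oo in *; simpl in *.
      revert Hw; unfold Rmin, Rmax; destruct (Rle_dec s0 u); lra.
    - apply (smooth_on_continuous I S t HS It). }
  exists (fun t => RInt S s0 t); split.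
  - apply (smooth_on_R I _ S); auto.
  - intros t It.
    assert (E : Derive (fun t => RInt S s0 t) t = S t)
      by (apply is_derive_unique, HL; auto).
    rewrite E.
    pose proof (Hn t It) as Hnt; split.
    + unfold S; apply Rmult_lt_0_compat; [now apply Rinv_0_lt_compat|].
      now apply sqrt_lt_R0.
    + unfold S; replace (s * (/ s * sqrt (n t))) with (sqrt (n t)) by (field; lra).
      rewrite pow2_sqrt; [unfold n; ring|lra].
Qed.

(** The image of [(a, b)] is a curve because its differential has rank one
    everywhere.  One of [a], [b] completes [phi] to coordinates; replacing it by
    the arclength parameter of the image curve keeps them coordinates. *)
Lemma rank_one_reparametrization D phi a b s p :
  open D -> smooth_on D phi -> smooth_on D a -> smooth_on D b -> 0 < s -> D p ->
  (forall q, D q -> jac a b q = 0) ->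
  (forall q v, D q -> dderiv a q v = 0 -> dderiv b q v = 0 ->
    dderiv phi q v = 0 -> v = zero) ->
  exists U V r f1 f2, open U /\ U p /\ (forall q, U q -> D q) /\ 0 < r /\
    smooth_on U V /\
    diffeomorphism2 U (box (phi p, V p) r) (fun q => (phi q, V q)) /\
    (forall q v, U q -> dderiv V q v = 0 ->
      dderiv a q v = 0 /\ dderiv b q v = 0) /\
    smooth_on (interval_oo (V p - r) (V p + r)) f1 /\
    smooth_on (interval_oo (V p - r) (V p + r)) f2 /\
    (forall q, U q -> a q = f1 (V q) /\ b q = f2 (V q)) /\
    (forall t, interval_oo (V p - r) (V p + r) t ->
      Derive f1 t ^ 2 + Derive f2 t ^ 2 = s ^ 2 /\
      exists q v, U q /\ V q = t /\ dderiv V q v <> 0).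
Proof.
  intros HD Hphi Ha Hb Hs Dp Hrank Hker.
  assert (Hlin : forall f q v, smooth_on D f -> D q ->
    dderiv f q v = fst v * partial1 f q + snd v * partial2 f q)
    by (intros; apply (dderiv_linear D); auto).
  (* [sg] is [a] or [b], chosen so that [(phi, sg)] has rank two at [p]. *)
  assert (Hsg : exists sg, smooth_on D sg /\ jac phi sg p <> 0 /\
    forall q v, D q -> (partial1 sg q <> 0 \/ partial2 sg q <> 0) ->
      dderiv sg q v = 0 -> dderiv a q v = 0 /\ dderiv b q v = 0).
  { assert (Hprop : forall f g q v, smooth_on D f -> smooth_on D g -> D q ->
      jac f g q = 0 -> (partial1 f q <> 0 \/ partial2 f q <> 0) ->
      dderiv f q v = 0 -> dderiv g q v = 0).
    { intros f g q v Hf Hg Dq; rewrite !Hlin; auto; unfold jac.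
      destruct v as [v1 v2]; simpl; intros E Hn E0.
      destruct Hn as [Hn|Hn];
        [apply (Rmult_eq_reg_l (partial1 f q))|apply (Rmult_eq_reg_l (partial2 f q))];
        auto.
      - transitivity (partial1 g q * (v1 * partial1 f q + v2 * partial2 f q)
          + v2 * (partial1 f q * partial2 g q - partial2 f q * partial1 g q)); [ring|].
        rewrite E, E0; ring.
      - transitivity (partial2 g q * (v1 * partial1 f q + v2 * partial2 f q)
          - v1 * (partial1 f q * partial2 g q - partial2 f q * partial1 g q)); [ring|].
        rewrite E, E0; ring. }
    assert (Hrank' : forall q, D q -> jac b a q = 0).
    { intros q Dq; generalize (Hrank q Dq); unfold jac; lra. }
    destruct (Req_dec (jac phi a p) 0) as [Ea|Hna].
    - exists b; split; [auto|split].
      + intros Eb.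
        assert (Hab : (partial1 a p <> 0 \/ partial2 a p <> 0) \/
          (partial1 b p <> 0 \/ partial2 b p <> 0) \/
          (partial1 a p = 0 /\ partial2 a p = 0 /\ partial1 b p = 0 /\ partial2 b p = 0)).
        { destruct (Req_dec (partial1 a p) 0), (Req_dec (partial2 a p) 0),
            (Req_dec (partial1 b p) 0), (Req_dec (partial2 b p) 0); tauto. }
        destruct Hab as [Hn|[Hn|[A1 [A2 [B1 B2]]]]].
        * destruct (jac_zero_kernel D phi a p) as [v [Hv [V1 V2]]]; auto.
          apply Hv, (Hker p); auto. apply (Hprop a b); auto.
        * destruct (jac_zero_kernel D phi b p) as [v [Hv [V1 V2]]]; auto.
          apply Hv, (Hker p); auto. apply (Hprop b a); auto.
        * destruct (jac_zero_kernel D phi a p) as [v [Hv [V1 V2]]]; auto.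
          apply Hv, (Hker p); auto; rewrite Hlin; auto.
          rewrite B1, B2; ring.
      + intros q v Dq Hn E; split; auto. apply (Hprop b a); auto.
    - exists a; split; [auto|split; auto].
      intros q v Dq Hn E; split; auto. apply (Hprop a b); auto. }
  destruct Hsg as [sg [Hsg [Hj Hdep]]].
  destruct (inverse_function D phi sg p HD Hphi Hsg Dp Hj)
    as [U1 [r1 [Hr1 [HU1 [U1p [HU1D Hdiff1]]]]]].
  assert (Hsub : forall f, smooth_on D f -> smooth_on U1 f).
  { intros f; apply smooth_on_subset; intros q Uq; apply HU1D; auto. }
  assert (Hjn : forall f q, jac phi f q <> 0 -> partial1 f q <> 0 \/ partial2 f q <> 0).
  { intros f q Hn; destruct (Req_dec (partial1 f q) 0) as [E1|]; auto.
    destruct (Req_dec (partial2 f q) 0) as [E2|]; auto.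
    exfalso; apply Hn; unfold jac; rewrite E1, E2; ring. }
  assert (Hdep1 : forall q v, U1 q -> dderiv sg q v = 0 ->
    dderiv a q v = 0 /\ dderiv b q v = 0).
  { intros q v Uq; destruct (HU1D q Uq); apply Hdep; auto. }
  set (I := interval_oo (sg p - r1) (sg p + r1)).
  assert (HI : open I) by apply open_interval_oo.
  assert (HsgI : forall q, U1 q -> I (sg q)).
  { intros q Uq; destruct Hdiff1 as [k [_ [_ [H _]]]].
    apply interval_oo_center, (H q Uq). }
  destruct (factor_through_second U1 phi sg a (phi p, sg p) r1) as [g1 [Hg1 Eg1]]; auto.
  { intros; apply Hdep1; auto. }
  destruct (factor_through_second U1 phi sg b (phi p, sg p) r1) as [g2 [Hg2 Eg2]]; auto.
  { intros; apply Hdep1; auto. }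
  simpl in Hg1, Hg2; fold I in Hg1, Hg2.
  assert (Da : forall q v, U1 q -> dderiv a q v = dderiv sg q v * Derive g1 (sg q))
    by (intros; apply (dderiv_comp1 U1 I); auto).
  assert (Db : forall q v, U1 q -> dderiv b q v = dderiv sg q v * Derive g2 (sg q))
    by (intros; apply (dderiv_comp1 U1 I); auto).
  assert (Hreg : forall t, I t -> Derive g1 t <> 0 \/ Derive g2 t <> 0).
  { intros t It.
    destruct Hdiff1 as [k [_ [_ [_ Hk]]]].
    destruct (Hk (phi p, t)) as [Uq Eq].
    { split; simpl; [rewrite Rminus_diag, Rabs_R0; auto|].
      now apply interval_oo_center. }
    set (q := k (phi p, t)) in *.
    injection Eq; intros Et _; rewrite <- Et.
    destruct (Req_dec (Derive g1 (sg q)) 0) as [E1|]; auto.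
    destruct (Req_dec (Derive g2 (sg q)) 0) as [E2|]; auto.
    exfalso.
    destruct (HU1D q Uq) as [Dq Hjq].
    assert (Hz : jac phi a q = 0).
    { unfold jac, partial1, partial2; rewrite !Da; auto; rewrite E1; ring. }
    destruct (jac_zero_kernel D phi a q) as [v [Hv [V1 V2]]]; auto.
    apply Hv, (Hker q); auto; rewrite Db, E2; auto; ring. }
  destruct (arclength (sg p - r1) (sg p + r1) (sg p) g1 g2 s) as [L [HL HLs]]; auto.
  { apply interval_oo_center; rewrite Rminus_diag, Rabs_R0; auto. }
  fold I in HL, HLs.
  set (V := fun q => L (sg q)).
  assert (HV : smooth_on U1 V) by (apply (smooth_on_comp1 U1 I L sg); auto).
  assert (DV : forall q v, U1 q -> dderiv V q v = dderiv sg q v * Derive L (sg q))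
    by (intros; apply (dderiv_comp1 U1 I); auto).
  assert (HjV : jac phi V p <> 0).
  { unfold jac, partial1, partial2; rewrite !DV; auto.
    destruct (HLs (sg p) (HsgI p U1p)) as [HLp _].
    intros E; apply Hj; unfold jac, partial1, partial2.
    apply Rmult_eq_reg_r with (Derive L (sg p)); lra. }
  destruct (inverse_function U1 phi V p HU1 (Hsub phi Hphi) HV U1p HjV)
    as [U [r [Hr [HU [Up [HUU1 Hdiff]]]]]].
  assert (Hsub' : forall f, smooth_on U1 f -> smooth_on U f).
  { intros f; apply smooth_on_subset; intros q Uq; apply HUU1; auto. }
  assert (HdepV : forall q v, U q -> dderiv V q v = 0 ->
    dderiv a q v = 0 /\ dderiv b q v = 0).
  { intros q v Uq E; destruct (HUU1 q Uq) as [U1q _]; apply Hdep1; auto.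
    rewrite DV in E; auto.
    destruct (HLs (sg q) (HsgI q U1q)) as [HLp _].
    destruct (Rmult_integral _ _ E); auto; lra. }
  destruct (factor_through_second U phi V a (phi p, V p) r) as [f1 [Hf1 Ef1]]; auto.
  { intros; apply HdepV; auto. }
  destruct (factor_through_second U phi V b (phi p, V p) r) as [f2 [Hf2 Ef2]]; auto.
  { intros; apply HdepV; auto. }
  simpl in Hf1, Hf2.
  exists U, V, r, f1, f2.
  assert (HVI : forall q, U q -> interval_oo (V p - r) (V p + r) (V q)).
  { intros q Uq; destruct Hdiff as [k [_ [_ [H _]]]].
    apply interval_oo_center, (H q Uq). }
  split; [auto|]; split; [auto|]; split.
  { intros q Uq; apply HU1D, HUU1; auto. }
  split; [auto|]; split; [auto|]; split; [auto|]; split; [auto|].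
  split; [auto|]; split; [auto|]; split; [auto|].
  intros t Ht.
  pose proof Hdiff as [k [_ [_ [_ Hk]]]].
  destruct (Hk (phi p, t)) as [Uq Eq].
  { split; simpl; [rewrite Rminus_diag, Rabs_R0; auto|].
    now apply interval_oo_center. }
  set (q := k (phi p, t)) in *.
  injection Eq; intros Et _; rewrite <- Et.
  destruct (HUU1 q Uq) as [U1q HjVq].
  destruct (HLs (sg q) (HsgI q U1q)) as [HLp HLe].
  (* A direction in which [sg] varies compares the speeds of both curves. *)
  assert (Hv : exists v, dderiv sg q v <> 0).
  { destruct (HU1D q U1q) as [_ Hjq]; destruct (Hjn sg q Hjq);
      [exists (1, 0)|exists (0, 1)]; auto. }
  destruct Hv as [v Hv]; split.
  2: { exists q, v; split; [auto|split; [auto|]]; rewrite DV; auto.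
       apply Rmult_integral_contrapositive; split; auto; lra. }
  assert (E1 : dderiv a q v = dderiv V q v * Derive f1 (V q))
    by (apply (dderiv_comp1 U (interval_oo (V p - r) (V p + r))); auto).
  assert (E2 : dderiv b q v = dderiv V q v * Derive f2 (V q))
    by (apply (dderiv_comp1 U (interval_oo (V p - r) (V p + r))); auto).
  rewrite DV in E1, E2; auto; rewrite Da in E1; auto; rewrite Db in E2; auto.
  rewrite Rmult_assoc in E1, E2.
  apply Rmult_eq_reg_l in E1; auto; apply Rmult_eq_reg_l in E2; auto.
  rewrite E1, E2 in HLe.
  apply Rmult_eq_reg_l with (Derive L (sg q) ^ 2); [|apply pow_nonzero; lra].
  transitivity ((s * Derive L (sg q)) ^ 2); [|ring].
  rewrite <- HLe; ring.
Qed.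

(** * Angle functions *)

Lemma unit_circle_angle c t : c * c + t * t = 1 -> exists phi, c = cos phi /\ t = sin phi.
Proof.
  intros E.
  assert (Hc : -1 <= c <= 1) by nra.
  assert (Es : sqrt (1 - c²) = Rabs t).
  { rewrite <- sqrt_Rsqr_abs; f_equal; unfold Rsqr; lra. }
  destruct (Rle_dec 0 t) as [Ht|Ht].
  - exists (acos c); rewrite cos_acos, sin_acos, Es, Rabs_pos_eq; auto.
  - exists (- acos c); rewrite cos_neg, sin_neg, cos_acos, sin_acos, Es, Rabs_left; auto.
    split; auto; ring. lra.
Qed.

Lemma cos_sin_atan c t : 0 < c -> c * c + t * t = 1 ->
  cos (atan (t / c)) = c /\ sin (atan (t / c)) = t.
Proof.
  intros Hc E; rewrite cos_atan, sin_atan.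
  replace (sqrt (1 + (t / c)²)) with (/ c); [split; field; lra|].
  replace (1 + (t / c)²) with ((/ c)²).
  - rewrite sqrt_Rsqr; auto; left; now apply Rinv_0_lt_compat.
  - unfold Rsqr; apply Rmult_eq_reg_r with (c * c); [|nra].
    transitivity (c * c + t * t); [rewrite E; field; lra|field; lra].
Qed.

Lemma smooth_angle U n1 n2 s (p : R * R) :
  open U -> smooth_on U n1 -> smooth_on U n2 -> 0 < s -> U p ->
  (forall q, U q -> n1 q ^ 2 + n2 q ^ 2 = s ^ 2) ->
  exists U1 phi, open U1 /\ U1 p /\ (forall q, U1 q -> U q) /\ smooth_on U1 phi /\
    forall q, U1 q -> n1 q = s * cos (phi q) /\ n2 q = s * sin (phi q).
Proof.
  intros HU H1 H2 Hs Up Hn.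
  destruct (unit_circle_angle (n1 p / s) (n2 p / s)) as [phi0 [C0 S0]].
  { generalize (Hn p Up); intros E; apply Rmult_eq_reg_r with (s ^ 2); [|nra].
    transitivity (n1 p ^ 2 + n2 p ^ 2); [field; lra|lra]. }
  pose proof (sin2_cos2 phi0) as SC; unfold Rsqr in SC.
  (* The angle is measured from its value [phi0] at [p], so that the branch of
     the arctangent is smooth near [p]. *)
  set (c := fun q => n1 q * (cos phi0 / s) + n2 q * (sin phi0 / s)).
  set (t := fun q => n2 q * (cos phi0 / s) - n1 q * (sin phi0 / s)).
  assert (Hc : smooth_on U c).
  { apply smooth_on_plus; auto; apply smooth_on_mult; auto using smooth_on_const. }
  assert (Ht : smooth_on U t).
  { apply smooth_on_minus; auto; apply smooth_on_mult; auto using smooth_on_const. }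
  assert (Hct : forall q, U q -> c q * c q + t q * t q = 1).
  { intros q Uq; unfold c, t.
    transitivity ((n1 q ^ 2 + n2 q ^ 2) / s ^ 2
      * (sin phi0 * sin phi0 + cos phi0 * cos phi0)); [field; lra|].
    rewrite Hn, SC; auto; field; lra. }
  assert (Hcp : 0 < c p).
  { replace (c p) with 1; [lra|]; unfold c.
    transitivity (n1 p / s * cos phi0 + n2 p / s * sin phi0); [|field; lra].
    rewrite C0, S0; lra. }
  exists (fun q => U q /\ 0 < c q), (fun q => phi0 + atan (t q * / c q)).
  assert (HU1 : open (fun q => U q /\ 0 < c q)).
  { intros q [Uq Hq]; apply filter_and; [now apply HU|].
    apply (smooth_on_continuous U c q Hc Uq (fun x => 0 < x)).
    apply open_gt; auto. }
  split; [exact HU1|]; split; [auto|]; split; [tauto|]; split.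
  - apply smooth_on_plus; auto using smooth_on_const.
    apply (smooth_on_comp1 _ (fun _ => True) atan); auto using smooth_atan, open_R.
    apply smooth_on_mult; auto; [apply (smooth_on_subset U); tauto|].
    apply smooth_on_inv; auto; [intros q [_ Hq]; lra|apply (smooth_on_subset U); tauto].
  - intros q [Uq Hq].
    destruct (cos_sin_atan (c q) (t q) Hq (Hct q Uq)) as [Ec Es]; unfold Rdiv in Ec, Es.
    rewrite cos_plus, sin_plus, Ec, Es; unfold c, t; split.
    + transitivity (n1 q * (sin phi0 * sin phi0 + cos phi0 * cos phi0));
        [rewrite SC; ring|field; lra].
    + transitivity (n2 q * (sin phi0 * sin phi0 + cos phi0 * cos phi0));
        [rewrite SC; ring|field; lra].
Qed.

(** * Surfaces in the Heisenberg group *)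

(** Applied to the coordinates of space, this shows that the identity is
    smooth and is its own differential. *)
Lemma smooth_linear {V : NormedModule R_AbsRing} (l : V -> R) :
  (forall p, continuous l p) ->
  (forall p v t, l (plus p (scal t v)) = l p + t * l v) ->
  smooth_on (fun _ => True) l /\ forall p v, dderiv l p v = l v.
Proof.
  intros Hc Hl.
  assert (HV : open (fun _ : V => True)) by apply open_true.
  assert (Hd : forall p v, is_dderiv l p v (l v)).
  { intros p v; apply (is_derive_ext (fun t => l p + t * l v)).
    - intros t; now rewrite Hl.
    - auto_derive; auto; ring. }
  split; [|intros; apply is_dderiv_unique; auto].
  intros [|k].
  - split; auto.
  - apply (Ck_on_S k _ l (fun v _ => l v)); auto; intros; now apply Ck_on_const.
Qed.

Lemma continuous_coordinates (p : R * R * R) :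
  continuous coordx p /\ continuous coordy p /\ continuous coordz p.
Proof.
  destruct p as [[x y] z]; split; [|split].
  - apply (continuous_comp (fst : R * R * R -> R * R) (fst : R * R -> R));
      apply continuous_fst.
  - apply (continuous_comp (fst : R * R * R -> R * R) (snd : R * R -> R));
      [apply continuous_fst|apply continuous_snd].
  - apply continuous_snd.
Qed.

Lemma nil_isometry_id tau : nil_isometry tau (fun p => p).
Proof.
  destruct (smooth_linear coordx) as [Sx Dx]; [apply continuous_coordinates|reflexivity|].
  destruct (smooth_linear coordy) as [Sy Dy]; [apply continuous_coordinates|reflexivity|].
  destruct (smooth_linear coordz) as [Sz Dz]; [apply continuous_coordinates|reflexivity|].
  assert (H : smooth_map3 (fun _ => True) (fun p : R * R * R => p))
    by (split; [|split]; auto).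
  split; [auto|split; [exists (fun p => p); auto|]].
  assert (Hd : forall p v : R * R * R, dmap3 (fun p => p) p v = v).
  { intros p v; transitivity (coordx v, coordy v, coordz v).
    - unfold dmap3; f_equal; [f_equal|]; [apply Dx|apply Dy|apply Dz].
    - now destruct v as [[? ?] ?]. }
  intros p v w; now rewrite !Hd.
Qed.

(** The third component of the normal in the orthonormal frame is the cosine of
    the angle; substituting it in the unit length and in the orthogonality to the
    tangent plane leaves conditions on the horizontal part. *)
Lemma constant_angle_normal tau theta U X N :
  0 <= theta <= PI / 2 -> constant_angle_surface tau theta U X N ->
  forall q, U q ->
    coordx (N q) ^ 2 + coordy (N q) ^ 2 = sin theta ^ 2 /\
    forall v, coordx (N q) * dderiv (fun q => coordx (X q)) q v
      + coordy (N q) * dderiv (fun q => coordy (X q)) q v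
      + cos theta * nil_form tau (X q) (dmap3 X q v) = 0.
Proof.
  intros Hth [_ [_ [[_ HN] Hang]]] q Uq.
  destruct (HN q Uq) as [Hnorm Horth].
  assert (Hsq : nil_metric tau (X q) (N q) (N q) = 1).
  { assert (E : nil_norm tau (X q) (N q) ^ 2 = 1) by (rewrite Hnorm; ring).
    unfold nil_norm in E; rewrite pow2_sqrt in E; auto.
    unfold nil_metric; nra. }
  assert (Hcos : nil_form tau (X q) (N q) = cos theta).
  { rewrite <- (Hang q Uq); unfold nil_angle; rewrite Hnorm.
    assert (F : nil_form tau (X q) nil_e3 = 1)
      by (unfold nil_form, nil_e3, coordx, coordy, coordz; simpl; ring).
    assert (E3 : nil_norm tau (X q) nil_e3 = 1).
    { unfold nil_norm, nil_metric; rewrite F; unfold nil_e3, coordx, coordy; simpl.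
      replace (0 * 0 + 0 * 0 + 1 * 1) with 1 by ring; apply sqrt_1. }
    rewrite E3; unfold nil_metric at 1; rewrite F.
    unfold nil_metric in Hsq.
    replace ((_ + _ + _) / (1 * 1)) with (nil_form tau (X q) (N q))
      by (unfold nil_e3, coordx at 2, coordy at 2; simpl; field).
    rewrite cos_acos; auto; nra. }
  split.
  - unfold nil_metric in Hsq; rewrite Hcos in Hsq.
    pose proof (sin2_cos2 theta) as E; unfold Rsqr in E; nra.
  - intros v; rewrite <- (Horth v); unfold nil_metric; rewrite Hcos; reflexivity.
Qed.

(** The exterior derivative of the relation in the hypothesis, in which the
    second derivatives of [x], [y], [z] cancel by symmetry. *)
Lemma normal_form_closed D n1 n2 x y z c tau q :
  open D -> smooth_on D n1 -> smooth_on D n2 ->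
  smooth_on D x -> smooth_on D y -> smooth_on D z ->
  (forall q v, D q -> n1 q * dderiv x q v + n2 q * dderiv y q v
    + c * (dderiv z q v + tau * (y q * dderiv x q v - x q * dderiv y q v)) = 0) ->
  D q ->
  jac x n1 q + jac y n2 q + 2 * tau * c * jac x y q = 0.
Proof.
  intros HD Hn1 Hn2 Hx Hy Hz E Dq.
  assert (Hd : forall f v w, smooth_on D f ->
    is_dderiv (fun q => dderiv f q v) q w (dderiv (fun q => dderiv f q v) q w)).
  { intros f v w Hf; apply (smooth_on_is_dderiv D); auto using smooth_on_dderiv. }
  assert (Hd0 : forall f w, smooth_on D f -> is_dderiv f q w (dderiv f q w)).
  { intros f w Hf; apply (smooth_on_is_dderiv D); auto. }
  assert (K : forall v w,
    (dderiv n1 q w * dderiv x q v + n1 q * dderiv (fun q => dderiv x q v) q w)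
    + (dderiv n2 q w * dderiv y q v + n2 q * dderiv (fun q => dderiv y q v) q w)
    + (0 * (dderiv z q v + tau * (y q * dderiv x q v - x q * dderiv y q v))
      + c * (dderiv (fun q => dderiv z q v) q w
        + (0 * (y q * dderiv x q v - x q * dderiv y q v)
          + tau * ((dderiv y q w * dderiv x q v + y q * dderiv (fun q => dderiv x q v) q w)
            - (dderiv x q w * dderiv y q v + x q * dderiv (fun q => dderiv y q v) q w)))))
    = 0).
  { intros v w.
    transitivity (dderiv (fun q => n1 q * dderiv x q v + n2 q * dderiv y q v
      + c * (dderiv z q v + tau * (y q * dderiv x q v - x q * dderiv y q v))) q w).
    - symmetry; apply is_dderiv_unique.
      apply is_dderiv_plus; [apply is_dderiv_plus|].
      + apply (is_dderiv_mult n1 (fun q => dderiv x q v)); [apply Hd0|apply Hd]; auto.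
      + apply (is_dderiv_mult n2 (fun q => dderiv y q v)); [apply Hd0|apply Hd]; auto.
      + apply (is_dderiv_mult (fun _ => c) (fun q => dderiv z q v
          + tau * (y q * dderiv x q v - x q * dderiv y q v))); [apply is_dderiv_const|].
        apply is_dderiv_plus; [apply Hd; auto|].
        apply (is_dderiv_mult (fun _ => tau)
          (fun q => y q * dderiv x q v - x q * dderiv y q v)); [apply is_dderiv_const|].
        apply is_dderiv_minus.
        * apply (is_dderiv_mult y (fun q => dderiv x q v)); [apply Hd0|apply Hd]; auto.
        * apply (is_dderiv_mult x (fun q => dderiv y q v)); [apply Hd0|apply Hd]; auto.
    - apply is_dderiv_unique.
      apply (is_derive_ext_loc (fun _ => 0)); [|apply (is_dderiv_const 0 q w)].
      generalize (locally_line D q w HD Dq); apply filter_imp; intros t Dt.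
      symmetry; apply E; auto. }
  pose proof (K (1, 0) (0, 1)) as K12; pose proof (K (0, 1) (1, 0)) as K21.
  assert (Sym : forall f, smooth_on D f ->
    dderiv (fun q => dderiv f q (0, 1)) q (1, 0) =
    dderiv (fun q => dderiv f q (1, 0)) q (0, 1))
    by (intros f Hf; apply (schwarz D f q HD Hf Dq)).
  rewrite (Sym x Hx), (Sym y Hy), (Sym z Hz) in K21.
  unfold jac, partial1, partial2; lra.
Qed.

(** The relation [n1 dx + n2 dy = 0] makes [dy] a multiple of [dx] wherever
    [dx] is not zero, which the coordinates [(z, x)] guarantee. *)
Lemma vertical_patch D x y z p :
  open D -> smooth_on D x -> smooth_on D y -> smooth_on D z -> D p ->
  (forall q, D q -> exists n1 n2, (n1 <> 0 \/ n2 <> 0) /\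
    forall v, n1 * dderiv x q v + n2 * dderiv y q v = 0) ->
  jac z x p <> 0 ->
  exists U r phi, open U /\ U p /\ (forall q, U q -> D q) /\
    smooth_on (interval_oo (x p - r) (x p + r)) phi /\
    (forall q, U q -> y q = phi (x q)) /\
    (forall q, U q -> interval_oo (x p - r) (x p + r) (x q) /\ Rabs (z q - z p) < r) /\
    (forall s t, interval_oo (x p - r) (x p + r) s -> Rabs (t - z p) < r ->
      exists q, U q /\ x q = s /\ z q = t).
Proof.
  intros HD Hx Hy Hz Dp Hn Hj.
  destruct (inverse_function D z x p HD Hz Hx Dp Hj)
    as [U [r [Hr [HU [Up [HUD Hdiff]]]]]].
  assert (Hsub : forall f, smooth_on D f -> smooth_on U f).
  { intros f; apply smooth_on_subset; intros q Uq; apply HUD; auto. }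
  destruct (factor_through_second U z x y (z p, x p) r) as [phi [Hphi Ephi]]; auto.
  { intros q v Uq Ev; destruct (HUD q Uq) as [Dq Hjq].
    destruct (Hn q Dq) as [n1 [n2 [Hne E]]].
    destruct (Req_dec n2 0) as [E2|H2].
    - exfalso; apply Hjq.
      assert (Hx0 : forall w, dderiv x q w = 0).
      { intros w; pose proof (E w) as Ew; rewrite E2 in Ew.
        apply Rmult_eq_reg_l with n1; [lra|destruct Hne; auto; contradiction]. }
      unfold jac, partial1, partial2; rewrite !Hx0; ring.
    - pose proof (E v) as Evv; rewrite Ev in Evv.
      apply Rmult_eq_reg_l with n2; lra. }
  exists U, r, phi; split; [auto|]; split; [auto|]; split.
  { intros q Uq; apply HUD; auto. }
  split; [auto|]; split; [auto|].
  destruct Hdiff as [k [_ [_ [H Hk]]]]; split.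
  - intros q Uq; destruct (H q Uq) as [[B1 B2] _]; split; auto.
    now apply interval_oo_center.
  - intros s t Hs Ht; destruct (Hk (t, s)) as [Uq Eq].
    { split; auto; now apply interval_oo_center. }
    exists (k (t, s)); injection Eq; auto.
Qed.

(** Of [n1] and [n2], one is nonzero at [p], and it tells over which vertical
    coordinate plane the surface is a graph. *)
Lemma vertical_surface D x y z (X : R * R -> R * R * R) p :
  open D -> smooth_on D x -> smooth_on D y -> smooth_on D z -> D p ->
  (forall q, X q = (x q, y q, z q)) ->
  (forall q v, D q -> dderiv x q v = 0 -> dderiv y q v = 0 -> dderiv z q v = 0 ->
    v = zero) ->
  (forall q, D q -> exists n1 n2, (n1 <> 0 \/ n2 <> 0) /\
    forall v, n1 * dderiv x q v + n2 * dderiv y q v = 0) ->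
  exists U, open U /\ U p /\ (forall q, U q -> D q) /\
    exists (a b : Rbar) c, regular_curve a b c /\
      open_part_of_set U X (hopf_cylinder a b c).
Proof.
  intros HD Hx Hy Hz Dp HX Himm Hn.
  destruct (Hn p Dp) as [n1 [n2 [Hne E]]].
  assert (Hid : forall u v : R, smooth_on (interval_oo u v) (fun s => s))
    by (intros; apply smooth_on_id, open_interval_oo).
  assert (HOx : forall f : R * R * R -> R, (forall q, continuous f q) -> forall u r w : R,
    open (fun q => interval_oo (u - r) (u + r) (f q) /\
      interval_oo (w - r) (w + r) (coordz q))).
  { intros f Hf u r w; apply open_and.
    - apply (open_comp f); [intros; apply Hf|apply open_interval_oo].
    - apply (open_comp coordz); [|apply open_interval_oo].
      intros; apply continuous_coordinates. }
  destruct (Req_dec n2 0) as [E2|H2].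
  - assert (H1 : n1 <> 0) by (destruct Hne; auto; contradiction).
    destruct (vertical_patch D y x z p) as [U [r [phi [HU [Up [HUD [Hphi [Ey [B S]]]]]]]]]; auto.
    { intros q Dq; destruct (Hn q Dq) as [m1 [m2 [Hm Em]]]; exists m2, m1; split; [tauto|].
      intros v; pose proof (Em v); lra. }
    { intros Hj; destruct (jac_zero_kernel D z y p) as [v [Hv [V1 V2]]]; auto.
      apply Hv, (Himm p); auto.
      pose proof (E v) as Ev; rewrite V2 in Ev.
      apply Rmult_eq_reg_l with n1; auto; lra. }
    exists U; split; [auto|]; split; [auto|]; split; [auto|].
    exists (Finite (y p - r)), (Finite (y p + r)), (fun s => (phi s, s)); split; [split|].
    + split; auto; apply Hid.
    + intros s Hs F; injection F; simpl; rewrite Derive_id; lra.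
    + exists (fun q => interval_oo (y p - r) (y p + r) (coordy q) /\
        interval_oo (z p - r) (z p + r) (coordz q)).
      split; [apply (HOx coordy); intros; apply continuous_coordinates|].
      intros q; split.
      * intros [q' [Uq' <-]]; rewrite HX; destruct (B q' Uq') as [B1 B2]; split.
        -- split; auto; now apply interval_oo_center.
        -- exists (y q'); split; auto.
           unfold hopf_fibration, coordx, coordy; simpl; now rewrite Ey.
      * intros [[O1 O2] [s [Hs Es]]]; injection Es; intros F1 F2.
        apply interval_oo_center in O2.
        destruct (S (coordy q) (coordz q) O1 O2) as [q' [Uq' [Eq1 Eq2]]].
        exists q'; split; auto; rewrite HX, Ey, Eq1, Eq2; auto.
        destruct q as [[? ?] ?]; unfold coordx, coordy, coordz in *; simpl in *; subst; auto.
  - destruct (vertical_patch D x y z p) as [U [r [phi [HU [Up [HUD [Hphi [Ey [B S]]]]]]]]]; auto.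
    { intros Hj; destruct (jac_zero_kernel D z x p) as [v [Hv [V1 V2]]]; auto.
      apply Hv, (Himm p); auto.
      pose proof (E v) as Ev; rewrite V2 in Ev.
      apply Rmult_eq_reg_l with n2; auto; lra. }
    exists U; split; [auto|]; split; [auto|]; split; [auto|].
    exists (Finite (x p - r)), (Finite (x p + r)), (fun s => (s, phi s)); split; [split|].
    + split; auto; apply Hid.
    + intros s Hs F; injection F; simpl; rewrite Derive_id; lra.
    + exists (fun q => interval_oo (x p - r) (x p + r) (coordx q) /\
        interval_oo (z p - r) (z p + r) (coordz q)).
      split; [apply (HOx coordx); intros; apply continuous_coordinates|].
      intros q; split.
      * intros [q' [Uq' <-]]; rewrite HX; destruct (B q' Uq') as [B1 B2]; split.
        -- split; auto; now apply interval_oo_center.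
        -- exists (x q'); split; auto.
           unfold hopf_fibration, coordx, coordy; simpl; now rewrite Ey.
      * intros [[O1 O2] [s [Hs Es]]]; injection Es; intros F1 F2.
        apply interval_oo_center in O2.
        destruct (S (coordx q) (coordz q) O1 O2) as [q' [Uq' [Eq1 Eq2]]].
        exists q'; split; auto; rewrite HX, Ey, Eq1, Eq2; auto.
        destruct q as [[? ?] ?]; unfold coordx, coordy, coordz in *; simpl in *; subst; auto.
Qed.

Lemma jac_nonzero_kernel D g1 g2 p (v : R * R) :
  open D -> smooth_on D g1 -> smooth_on D g2 -> D p -> jac g1 g2 p <> 0 ->
  dderiv g1 p v = 0 -> dderiv g2 p v = 0 -> v = zero.
Proof.
  intros HD H1 H2 Dp Hj.
  rewrite (dderiv_linear D g1), (dderiv_linear D g2); auto; unfold jac in Hj.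
  destruct v as [v1 v2]; simpl; intros E1 E2.
  assert (Z1 : v1 = 0).
  { apply Rmult_eq_reg_r with (jac g1 g2 p); [|exact Hj]; unfold jac.
    transitivity (partial2 g2 p * (v1 * partial1 g1 p + v2 * partial2 g1 p)
      - partial2 g1 p * (v1 * partial1 g2 p + v2 * partial2 g2 p)); [ring|].
    rewrite E1, E2; ring. }
  assert (Z2 : v2 = 0).
  { apply Rmult_eq_reg_r with (jac g1 g2 p); [|exact Hj]; unfold jac.
    transitivity (partial1 g1 p * (v1 * partial1 g2 p + v2 * partial2 g2 p)
      - partial1 g2 p * (v1 * partial1 g1 p + v2 * partial2 g1 p)); [ring|].
    rewrite E1, E2; ring. }
  now rewrite Z1, Z2.
Qed.

(** The hypothesis on the differentials is the orthogonality of the tangent plane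
    to the normal with horizontal part in direction [phi], divided by
    [cos theta]. *)
Lemma rotating_normal_surface D x y z phi tau theta (X : R * R -> R * R * R) p :
  open D -> smooth_on D x -> smooth_on D y -> smooth_on D z -> smooth_on D phi ->
  tau <> 0 -> 0 < sin theta -> tan theta <> 0 -> D p ->
  (forall q, X q = (x q, y q, z q)) ->
  (forall q, D q -> jac x y q <> 0) ->
  (forall q v, D q ->
    tan theta * cos (phi q) * dderiv x q v + tan theta * sin (phi q) * dderiv y q v
    + 1 * (dderiv z q v + tau * (y q * dderiv x q v - x q * dderiv y q v)) = 0) ->
  exists U, open U /\ U p /\ (forall q, U q -> D q) /\
    exists (a b : Rbar) f1 f2 f3, type_ii_data theta a b f1 f2 f3 /\
      open_part_of_param U X (fun q => interval_oo a b (snd q))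
        (type_ii_param tau theta f1 f2 f3).
Proof.
  intros HD Hx Hy Hz Hphi Htau Hs Hm Dp HX Hj E.
  set (m := tan theta) in *.
  set (r := m / (2 * tau)).
  assert (Emr : m = 2 * tau * r) by (unfold r; field; auto).
  assert (Hsin : smooth_on D (fun q => sin (phi q))).
  { apply (smooth_on_comp1 D (fun _ => True) sin); auto using open_R.
    apply smooth_sin_cos. }
  assert (Hcos : smooth_on D (fun q => cos (phi q))).
  { apply (smooth_on_comp1 D (fun _ => True) cos); auto using open_R.
    apply smooth_sin_cos. }
  assert (Hd : forall f q v, smooth_on D f -> D q -> is_dderiv f q v (dderiv f q v)).
  { intros f q v Hf Dq; apply (smooth_on_is_dderiv D); auto. }
  assert (Dsin : forall q v, D q ->
    is_dderiv (fun q => sin (phi q)) q v (dderiv phi q v * cos (phi q))).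
  { intros q v Dq; apply is_dderiv_comp1; auto using is_derive_sin. }
  assert (Dcos : forall q v, D q ->
    is_dderiv (fun q => cos (phi q)) q v (dderiv phi q v * - sin (phi q))).
  { intros q v Dq; apply is_dderiv_comp1; auto using is_derive_cos. }
  assert (DZ : forall (c : R) f q v a, is_dderiv f q v a ->
    is_dderiv (fun q : R * R => c * f q) q v (c * a)).
  { intros c f q v a Hf; replace (c * a) with (0 * f q + c * a) by ring.
    apply (is_dderiv_mult (fun _ => c) f); auto using is_dderiv_const. }
  (* [(A, B)] is the centre of the circle of radius [r] swept by the projection
     to the plane while [phi] turns. *)
  set (A := fun q => x q - r * sin (phi q)).
  set (B := fun q => y q + r * cos (phi q)).
  assert (HA : smooth_on D A).
  { apply smooth_on_minus; auto; apply smooth_on_mult; auto using smooth_on_const. }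
  assert (HB : smooth_on D B).
  { apply smooth_on_plus; auto; apply smooth_on_mult; auto using smooth_on_const. }
  assert (DA : forall q v, D q ->
    dderiv A q v = dderiv x q v - r * (dderiv phi q v * cos (phi q))).
  { intros q v Dq; apply is_dderiv_unique; apply is_dderiv_minus; auto. }
  assert (DB : forall q v, D q ->
    dderiv B q v = dderiv y q v + r * (dderiv phi q v * - sin (phi q))).
  { intros q v Dq; apply is_dderiv_unique; apply is_dderiv_plus; auto. }
  assert (HAB : forall q, D q -> jac A B q = 0).
  { intros q Dq.
    pose proof (normal_form_closed D (fun q => m * cos (phi q)) (fun q => m * sin (phi q))
      x y z 1 tau q HD) as C.
    assert (Dn1 : forall v, dderiv (fun q => m * cos (phi q)) q v
      = m * (dderiv phi q v * - sin (phi q)))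
      by (intros; apply is_dderiv_unique; auto).
    assert (Dn2 : forall v, dderiv (fun q => m * sin (phi q)) q v
      = m * (dderiv phi q v * cos (phi q)))
      by (intros; apply is_dderiv_unique; auto).
    assert (C' : _) by (apply C; auto; apply smooth_on_mult; auto using smooth_on_const).
    clear C; revert C'.
    unfold jac, partial1, partial2; rewrite !DA, !DB, !Dn1, !Dn2; auto.
    rewrite Emr; intros C.
    apply Rmult_eq_reg_l with (2 * tau); [|lra].
    match type of C with ?L = _ => transitivity L; [ring|rewrite C; ring] end. }
  destruct (rank_one_reparametrization D phi A B (sin theta) p)
    as [U [V [rho [f1 [f2 [HU [Up [HUD [Hrho [HV [Hdiff [HdepV
      [Hf1 [Hf2 [Ef Hspeed]]]]]]]]]]]]]]]; auto.
  { intros q v Dq EA EB Ephi; rewrite DA, Ephi in EA; auto; rewrite DB, Ephi in EB; auto.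
    apply (jac_nonzero_kernel D x y q v); auto; lra. }
  set (I := interval_oo (V p - rho) (V p + rho)) in *.
  assert (HI : open I) by apply open_interval_oo.
  assert (HVI : forall q, U q -> I (V q)).
  { intros q Uq; destruct Hdiff as [k [_ [_ [H _]]]].
    apply interval_oo_center, (H q Uq). }
  (* The value of [f3] forced by the third coordinate. *)
  set (G := fun q => (- / tau) * (z q + tau * r ^ 2 * phi q
    + tau * r * (cos (phi q) * A q + sin (phi q) * B q))).
  assert (HG : smooth_on D G).
  { assert (HC : forall (c : R) f, smooth_on D f -> smooth_on D (fun q => c * f q))
      by (intros; apply smooth_on_mult; auto using smooth_on_const).
    apply HC, smooth_on_plus; auto; [apply smooth_on_plus; auto|].
    apply HC, smooth_on_plus; auto; apply smooth_on_mult; auto. }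
  assert (DG : forall q v, D q ->
    dderiv G q v = dderiv A q v * B q - A q * dderiv B q v).
  { intros q v Dq.
    transitivity ((- / tau) * (dderiv z q v + tau * r ^ 2 * dderiv phi q v
      + tau * r * ((dderiv phi q v * - sin (phi q) * A q + cos (phi q) * dderiv A q v)
        + (dderiv phi q v * cos (phi q) * B q + sin (phi q) * dderiv B q v)))).
    { apply is_dderiv_unique, DZ.
      apply is_dderiv_plus; [apply is_dderiv_plus|].
      - auto.
      - apply DZ; auto.
      - apply DZ; apply is_dderiv_plus.
        + apply (is_dderiv_mult (fun q => cos (phi q)) A); auto.
        + apply (is_dderiv_mult (fun q => sin (phi q)) B); auto. }
    pose proof (E q v Dq) as Eq.
    rewrite DA, DB; auto; unfold A, B.
    assert (Ez : dderiv z q v = - (m * cos (phi q) * dderiv x q v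
      + m * sin (phi q) * dderiv y q v
      + tau * (y q * dderiv x q v - x q * dderiv y q v))) by lra.
    rewrite Ez, Emr.
    pose proof (sin2_cos2 (phi q)) as SC; unfold Rsqr in SC.
    apply Rminus_diag_uniq.
    transitivity (- r ^ 2 * dderiv phi q v
      * (1 - (sin (phi q) * sin (phi q) + cos (phi q) * cos (phi q)))); [|rewrite SC; ring].
    field; auto. }
  destruct (factor_through_second U phi V G (phi p, V p) rho) as [f3 [Hf3 Ef3]]; auto.
  { apply (smooth_on_subset D); auto. }
  { intros q v Uq Ev; destruct (HdepV q v Uq Ev) as [EA EB].
    rewrite DG, EA, EB; auto; ring. }
  simpl in Hf3; fold I in Hf3.
  exists U; split; [auto|]; split; [auto|]; split; [auto|].
  exists (Finite (V p - rho)), (Finite (V p + rho)), f1, f2, f3; split.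
  - split; [auto|]; split; [auto|]; split; [auto|].
    intros t It; destruct (Hspeed t It) as [Esp [q [v [Uq [<- Hv]]]]]; split; auto.
    assert (Chain : forall f F, smooth_on I F -> (forall q, U q -> f q = F (V q)) ->
      dderiv f q v = dderiv V q v * Derive F (V q)).
    { intros f F HF EF; apply (dderiv_comp1 U I); auto. }
    pose proof (Chain A f1 Hf1 (fun q Uq => proj1 (Ef q Uq))) as C1.
    pose proof (Chain B f2 Hf2 (fun q Uq => proj2 (Ef q Uq))) as C2.
    pose proof (Chain G f3 Hf3 Ef3) as C3.
    rewrite DG, C1, C2 in C3; auto.
    destruct (Ef q Uq) as [<- <-].
    apply Rmult_eq_reg_l with (dderiv V q v); auto; lra.
  - exists (box (phi p, V p) rho), (fun q => (phi q, V q)).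
    split; [apply open_box|]; split; [|split; auto].
    + intros q [_ Hq]; now apply interval_oo_center.
    + intros q Uq; rewrite HX; unfold type_ii_param; simpl.
      destruct (Ef q Uq) as [<- <-]; rewrite <- Ef3; auto.
      fold m; unfold G, A, B; rewrite Emr.
      f_equal; [f_equal|]; field; auto.
Qed.

Theorem theorem1 (tau theta : R) (U : R * R -> Prop)
    (X N : R * R -> R * R * R) :
  tau <> 0 ->
  0 <= theta <= PI / 2 ->
  constant_angle_surface tau theta U X N ->
  forall p : R * R, U p ->
  exists U' : R * R -> Prop,
    open U' /\ U' p /\ (forall q, U' q -> U q) /\
    exists Phi : R * R * R -> R * R * R,
      nil_isometry tau Phi /\
      ((exists (a b : Rbar) (c : R -> R * R),
          regular_curve a b c /\
          open_part_of_set U' (fun q => Phi (X q)) (hopf_cylinder a b c)) \/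
       (theta <> PI / 2 /\
        exists (a b : Rbar) (f1 f2 f3 : R -> R),
          type_ii_data theta a b f1 f2 f3 /\
          open_part_of_param U' (fun q => Phi (X q))
            (fun q => interval_oo a b (snd q))
            (type_ii_param tau theta f1 f2 f3))).
Proof.
  intros Htau Hth HM p Up.
  pose proof (constant_angle_normal tau theta U X N Hth HM) as Hnormal.
  destruct HM as [HU [[[Hx [Hy Hz]] Himm] [[[Hn1 [Hn2 _]] _] _]]].
  set (x := fun q : R * R => coordx (X q)); set (y := fun q : R * R => coordy (X q)).
  set (z := fun q : R * R => coordz (X q)).
  set (n1 := fun q : R * R => coordx (N q)); set (n2 := fun q : R * R => coordy (N q)).
  change (smooth_on U x) in Hx; change (smooth_on U y) in Hy; change (smooth_on U z) in Hz.
  change (smooth_on U n1) in Hn1; change (smooth_on U n2) in Hn2.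
  assert (HX : forall q, X q = (x q, y q, z q))
    by (intros q; unfold x, y, z; now destruct (X q) as [[? ?] ?]).
  assert (Hker : forall q v, U q ->
    dderiv x q v = 0 -> dderiv y q v = 0 -> dderiv z q v = 0 -> v = zero).
  { intros q v Uq E1 E2 E3; apply (Himm q Uq).
    change ((dderiv x q v, dderiv y q v, dderiv z q v) = (0, 0, 0)).
    now rewrite E1, E2, E3. }
  assert (Hsq : forall q, U q -> n1 q ^ 2 + n2 q ^ 2 = sin theta ^ 2)
    by (intros q Uq; apply (Hnormal q Uq)).
  assert (E : forall q v, U q -> n1 q * dderiv x q v + n2 q * dderiv y q v
    + cos theta * (dderiv z q v + tau * (y q * dderiv x q v - x q * dderiv y q v)) = 0)
    by (intros q v Uq; apply (Hnormal q Uq)).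
  destruct (Req_dec theta (PI / 2)) as [Eth|Nth].
  - destruct (vertical_surface U x y z X p) as [U' [HU' [U'p [HUU' Hcyl]]]]; auto.
    { intros q Uq; exists (n1 q), (n2 q); split.
      - generalize (Hsq q Uq); rewrite Eth, sin_PI2; intros Es.
        destruct (Req_dec (n1 q) 0) as [E1|]; auto; right; intros E2.
        rewrite E1, E2 in Es; lra.
      - intros v; pose proof (E q v Uq) as Ev; rewrite Eth, cos_PI2 in Ev; lra. }
    exists U'; split; [auto|]; split; [auto|]; split; [auto|].
    exists (fun q => q); split; [apply nil_isometry_id|left; exact Hcyl].
  - assert (Hcos : 0 < cos theta) by (apply cos_gt_0; pose proof PI_RGT_0; lra).
    (* The normal is not horizontal, so the surface projects locally
       diffeomorphically to the plane. *)
    assert (Hj : forall q, U q -> jac x y q <> 0).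
    { intros q Uq Ej.
      destruct (jac_zero_kernel U x y q) as [v [Hv [V1 V2]]]; auto.
      apply Hv, (Hker q v); auto.
      pose proof (E q v Uq) as Ev; rewrite V1, V2 in Ev.
      apply Rmult_eq_reg_l with (cos theta); lra. }
    destruct (Req_dec theta 0) as [E0|N0].
    + exfalso; apply (Hj p Up).
      assert (Hn0 : forall q, U q -> n1 q = 0 /\ n2 q = 0).
      { intros q Uq; generalize (Hsq q Uq); rewrite E0, sin_0; intros Es.
        split; nra. }
      set (O := (fun _ => 0) : R * R -> R).
      assert (C : jac x O p + jac y O p + 2 * tau * cos theta * jac x y p = 0).
      { assert (HO : smooth_on U O) by exact (smooth_on_const U 0 HU).
        apply (normal_form_closed U O O x y z (cos theta) tau p HU HO HO Hx Hy Hz); auto.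
        intros q v Uq; destruct (Hn0 q Uq) as [Z1 Z2].
        generalize (E q v Uq); now rewrite Z1, Z2. }
      assert (J0 : forall f, jac f O p = 0).
      { assert (D0 : forall v : R * R, dderiv O p v = 0)
          by (intros v; exact (is_dderiv_unique O p v 0 (is_dderiv_const 0 p v))).
        intros f; unfold jac, partial1, partial2; rewrite !D0; ring. }
      rewrite !J0 in C.
      apply Rmult_eq_reg_l with (2 * tau * cos theta); [lra|].
      repeat apply Rmult_integral_contrapositive_currified; lra.
    + assert (Hsin : 0 < sin theta) by (apply sin_gt_0; pose proof PI_RGT_0; lra).
      destruct (smooth_angle U n1 n2 (sin theta) p)
        as [U1 [phi [HU1 [U1p [HUU1 [Hphi Eang]]]]]]; auto.
      assert (Hsub : forall f, smooth_on U f -> smooth_on U1 f)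
        by (intros f; apply smooth_on_subset; auto).
      assert (Htan : tan theta <> 0).
      { apply Rgt_not_eq, tan_gt_0; lra. }
      destruct (rotating_normal_surface U1 x y z phi tau theta X p)
        as [U' [HU' [U'p [HUU' Htype]]]]; auto.
      { intros q v U1q; pose proof (E q v (HUU1 q U1q)) as Ev.
        destruct (Eang q U1q) as [A1 A2]; rewrite A1, A2 in Ev.
        apply Rmult_eq_reg_l with (cos theta); [|lra].
        rewrite Rmult_0_r; etransitivity; [|exact Ev].
        unfold tan; field; lra. }
      exists U'; split; [auto|]; split; [auto|]; split; [auto|].
      exists (fun q => q); split; [apply nil_isometry_id|right; split; auto].
Qed.
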